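(* Let $\Bbbk$ be a field and let $H$ be a Hopf algebra over $\Bbbk$ such that the left trivial module ${}_\varepsilon\Bbbk$ or the right trivial module $\Bbbk_\varepsilon$ has a resolution by finitely generated projective $H$-modules (left, respectively right). Suppose $H$ satisfies one of the following conditions: (i) $\dim_{\Bbbk} \operatorname{Ext}_{H}^i({}_\varepsilon \Bbbk, H)=1$ for some integer $i\ge 0$; (ii) $\dim_{\Bbbk} \operatorname{Ext}_{H^{\mathrm{op}}}^j(\Bbbk_\varepsilon,H)=1$ for some integer $j\ge 0$. Then the antipode of $H$ is injective. Moreover, if both (i) and (ii) hold for $H$ with $i=j$, and $H$ additionally has one of the following properties: (iii) every left invertible element of $H$ is regular; (iv) every right invertible element of $H$ is regular; then the antipode of $H$ is bijective.
   Context: $H$ is a Hopf algebra over a field $\Bbbk$ with counit $\varepsilon$; it is not assumed noetherian and its antipode is not assumed bijective. ${}_\varepsilon\Bbbk$ (resp. $\Bbbk_\varepsilon$) denotes the one-dimensional left (resp. right) $H$-module on which $H$ acts through $\varepsilon$. $\operatorname{Ext}_H$ is computed in the category of left $H$-modules and $\operatorname{Ext}_{H^{\mathrm{op}}}$ in the category of right $H$-modules. Resolutions may be infinite in length. An element of a ring is regular if it is neither a left nor a right zero divisor. *)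

(* Defs.v *)
From HB Require Import structures.
From mathcomp Require Import all_boot all_algebra.
From mathcomp Require Import boolp.
From mathcomp Require Import freeg.

Set Implicit Arguments.
Unset Strict Implicit.
Unset Printing Implicit Defensive.

Import GRing.Theory.
Import Quotient.Exports.

Local Open Scope ring_scope.
Local Open Scope quotient_scope.

Definition is_submodule (R : pzRingType) (V : lmodType R) (S : V -> Prop) : Prop :=
  S 0 /\ (forall (a : R) (u v : V), S u -> S v -> S (a *: u + v)).

Section QuotientModule.
Variables (R : pzRingType) (V : lmodType R) (S : V -> Prop).
Hypothesis S_sub : is_submodule S.

Definition submodule_pred of is_submodule S := fun v : V => `[< S v >].
Local Notation Sb := (submodule_pred S_sub).

Fact submodule_pred_closed : zmod_closed Sb.
Proof.
case: (S_sub) => S0 SP; split=> [|u v /asboolP Su /asboolP Sv]; apply/asboolP=> //.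
by rewrite addrC -scaleN1r; apply: SP.
Qed.
HB.instance Definition _ := GRing.isZmodClosed.Build V Sb submodule_pred_closed.

Definition submodule_zmod : zmodClosed V := GRing.ZmodClosed.clone V Sb _.
Definition quotmod : Type := Quotient.quot submodule_zmod.
HB.instance Definition _ := GRing.Zmodule.on quotmod.

Definition qproj (v : V) : quotmod := \pi_(Quotient.quot submodule_zmod) v.
Definition qrepr (x : quotmod) : V := repr (x : Quotient.quot submodule_zmod).

Lemma qreprK (x : quotmod) : qproj (qrepr x) = x.
Proof. exact: reprK. Qed.

Lemma qproj_eq (u v : V) : (qproj u = qproj v) <-> S (u - v).
Proof.
split=> [/eqP|uv].
  by rewrite -Quotient.idealrBE => /asboolP.
by apply/eqP; rewrite -Quotient.idealrBE; apply/asboolP.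
Qed.

Lemma qprojD (u v : V) : qproj (u + v) = qproj u + qproj v.
Proof. by rewrite /qproj raddfD. Qed.

Definition qscale (a : R) (x : quotmod) : quotmod := qproj (a *: qrepr x).

Lemma qprojZ (a : R) (v : V) : qproj (a *: v) = qscale a (qproj v).
Proof.
case: (S_sub) => S0 SP.
apply/qproj_eq; rewrite -scalerBr -[_ *: _]addr0; apply: SP => //.
by apply/qproj_eq; rewrite qreprK.
Qed.

Fact qscaleA a b x : qscale a (qscale b x) = qscale (a * b) x.
Proof. by rewrite -[x]qreprK -!qprojZ scalerA. Qed.
Fact qscale1 : left_id 1 qscale.
Proof. by move=> x; rewrite -[x]qreprK -!qprojZ scale1r. Qed.
Fact qscaleDr : right_distributive qscale +%R.
Proof.
by move=> a x y; rewrite -[x]qreprK -[y]qreprK -qprojD -!qprojZ scalerDr qprojD.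
Qed.
Fact qscaleDl x : {morph qscale^~ x : a b / a + b}.
Proof. by move=> a b; rewrite -[x]qreprK -!qprojZ scalerDl qprojD. Qed.

HB.instance Definition _ :=
  GRing.Zmodule_isLmodule.Build R quotmod qscaleA qscale1 qscaleDr qscaleDl.

Fact qproj_linear : linear qproj.
Proof. by move=> a u v; rewrite qprojD qprojZ. Qed.
HB.instance Definition _ := GRing.isLinear.Build R V quotmod _ qproj qproj_linear.

End QuotientModule.

Lemma fglift_linear (R : nzRingType) (M : lmodType R) (K : choiceType)
  (f : K -> M) : linear (fglift f).
Proof.
have addf : additive (fglift f) by exact: lift_is_additive.
pose F : {additive {freeg K / R} -> M} :=
  HB.pack (fglift f) (GRing.isZmodMorphism.Build _ _ _ addf).
have sumF I (r : seq I) (G : I -> {freeg K / R}) :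
  fglift f (\sum_(i <- r) G i) = \sum_(i <- r) fglift f (G i).
  exact: (raddf_sum F).
have ZF a D : fglift f (a *: D) = a *: fglift f D.
  rewrite -[D in RHS]freeg_sumE !sumF scaler_sumr.
  by apply: eq_bigr => x _; rewrite !liftU scalerA.
by move=> a u v; rewrite -ZF; exact: (raddfD F).
Qed.
HB.instance Definition _ (R : nzRingType) (M : lmodType R) (K : choiceType)
    (f : K -> M) :=
  GRing.isLinear.Build R {freeg K / R} M _ (fglift f) (fglift_linear f).

(* The tensor product over k: the free module on pairs modulo the submodule
   generated by the bilinearity relations. *)

Section Tensor.
Variables (k : fieldType) (U V : lmodType k).

Inductive tensor_rel : {freeg (U * V)%type / k} -> Prop :=
| TensorRel0 : tensor_rel 0
| TensorRelP a x y : tensor_rel x -> tensor_rel y -> tensor_rel (a *: x + y)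
| TensorRelL a u u' v :
    tensor_rel (<< (a *: u + u', v) >> - (a *: << (u, v) >> + << (u', v) >>))
| TensorRelR a u v v' :
    tensor_rel (<< (u, a *: v + v') >> - (a *: << (u, v) >> + << (u, v') >>)).

Fact tensor_rel_submodule : is_submodule tensor_rel.
Proof. by split=> [|a x y]; [exact: TensorRel0 | exact: TensorRelP]. Qed.

Definition tensor : Type := quotmod tensor_rel_submodule.
HB.instance Definition _ := GRing.Lmodule.on tensor.

Definition tens (u : U) (v : V) : tensor :=
  qproj tensor_rel_submodule << (u, v) >>.

Lemma tensPl (v : V) : linear (tens^~ v).
Proof.
move=> a u u'; rewrite /tens -linearP /=; apply/qproj_eq.
exact: TensorRelL.
Qed.

Lemma tensPr (u : U) : linear (tens u).
Proof.
move=> a v v'; rewrite /tens -linearP /=; apply/qproj_eq.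
exact: TensorRelR.
Qed.

Lemma tensor_ind (P : tensor -> Prop) :
  P 0 -> (forall a u v x, P x -> P (a *: tens u v + x)) -> forall x, P x.
Proof.
move=> P0 PS x; rewrite -[x]qreprK -[qrepr x]freeg_sumE linear_sum /=.
elim: (dom _) => [|[u v] s IHs]; first by rewrite big_nil.
rewrite big_cons -[<< _ *g _ >>](_ : coeff (u, v) (qrepr x) *: << (u, v) >> = _).
  by rewrite linearZ; exact: PS.
by apply/eqP/freeg_eqP => y; rewrite coeffZ !coeffU mul1r.
Qed.

End Tensor.

Notation "u *t v" := (tens u v) (at level 40, left associativity).

(* The linear map U (x) V -> W induced by a bilinear map f (see tliftE); the
   definition makes sense for any f, but is meaningful only for bilinear ones. *)

Section TensorLift.
Variables (k : fieldType) (U V W : lmodType k) (f : U -> V -> W).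

Definition tlift (x : tensor U V) : W :=
  fglift (fun uv : U * V => f uv.1 uv.2) (qrepr x).

Hypothesis (fl : forall v, linear (f^~ v)) (fr : forall u, linear (f u)).

Lemma tlift_rel (x : {freeg (U * V)%type / k}) :
  tensor_rel x -> fglift (fun uv : U * V => f uv.1 uv.2) x = 0.
Proof.
elim=> [|a {}x y _ IHx _ IHy|a u u' v|a u v v'].
- by rewrite linear0.
- by rewrite linearP /= IHx IHy scaler0 addr0.
- by rewrite linearB linearP /= !liftU !scale1r /= fl subrr.
- by rewrite linearB linearP /= !liftU !scale1r /= fr subrr.
Qed.

Lemma tlift_qproj (x : {freeg (U * V)%type / k}) :
  tlift (qproj (@tensor_rel_submodule k U V) x) = fglift (fun uv : U * V => f uv.1 uv.2) x.
Proof.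
apply/eqP; rewrite /tlift -subr_eq0 -linearB /=; apply/eqP/tlift_rel.
by apply/(qproj_eq (@tensor_rel_submodule k U V)); rewrite qreprK.
Qed.

Lemma tliftE u v : tlift (u *t v) = f u v.
Proof. by rewrite /tens tlift_qproj liftU scale1r. Qed.

Lemma tlift_linear : linear tlift.
Proof.
move=> a x y; rewrite -[x]qreprK -[y]qreprK -linearP !tlift_qproj.
exact: linearP.
Qed.

End TensorLift.

Lemma linE (k : fieldType) (W W' : lmodType k) (f : W -> W') : linear f ->
  (f 0 = 0) * (forall a x y, f (a *: x + y) = a *: f x + f y).
Proof.
move=> lf; split=> //.
pose F : {linear W -> W'} := HB.pack f (GRing.isLinear.Build _ _ _ _ _ lf).
exact: (linear0 F).
Qed.

Section TensorMaps.
Variable k : fieldType.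

Definition tmap (U U' V V' : lmodType k) (f : U -> U') (g : V -> V') :
    tensor U V -> tensor U' V' :=
  tlift (fun u v => f u *t g v).

Lemma tmapE (U U' V V' : lmodType k) (f : {linear U -> U'}) (g : {linear V -> V'}) u v :
  tmap f g (u *t v) = f u *t g v.
Proof.
apply: (@tliftE k U V _ (fun u v => f u *t g v)) => [{}v|{}u] a x y.
  by rewrite linearP tensPl.
by rewrite linearP tensPr.
Qed.

Definition tassoc (U V W : lmodType k) : tensor (tensor U V) W -> tensor U (tensor V W) :=
  tlift (fun (x : tensor U V) (w : W) => tlift (fun u v => u *t (v *t w)) x).

Lemma tassocE (U V W : lmodType k) (u : U) (v : V) (w : W) :
  tassoc (u *t v *t w) = u *t (v *t w).
Proof.
have l1 (w' : W) (v' : V) : linear (fun u' : U => u' *t (v' *t w')) by exact: tensPl.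
have l2 (w' : W) (u' : U) : linear (fun v' : V => u' *t (v' *t w')).
  by move=> a x y; rewrite tensPl tensPr.
have l3 (w' : W) := tlift_linear (l1 w') (l2 w').
rewrite /tassoc tliftE ?(tliftE (l1 w) (l2 w)) // => x a y z.
elim/tensor_ind: x => [|b u' v' x IHx].
  by rewrite !(linE (l3 _)) scaler0 addr0.
rewrite !l3 IHx !(tliftE (l1 _) (l2 _)) tensPr tensPr.
by rewrite !scalerDr !scalerA mulrC addrACA.
Qed.

End TensorMaps.

(* The algebra A (x) B, with (a (x) b)(a' (x) b') = aa' (x) bb'. *)

Section TensorAlgebra.
Variables (k : fieldType) (A B : algType k).
Local Notation T := (tensor A B).

Definition tmul (x y : T) : T :=
  tlift (fun a b => tlift (fun a' b' => (a * a') *t (b * b')) y) x.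

Fact tmul_inner_l a b (b' : B) : linear (fun a' : A => (a * a') *t (b * b') : T).
Proof. by move=> c u v; rewrite mulrDr -scalerAr tensPl. Qed.
Fact tmul_inner_r a b (a' : A) : linear (fun b' : B => (a * a') *t (b * b') : T).
Proof. by move=> c u v; rewrite mulrDr -scalerAr tensPr. Qed.

Let inner_linear a b :
  linear (tlift (fun (a' : A) (b' : B) => (a * a') *t (b * b') : T)).
Proof. exact: tlift_linear (tmul_inner_l a b) (tmul_inner_r a b). Qed.

Let innerE a b a' b' :
  tlift (fun (a' : A) (b' : B) => (a * a') *t (b * b') : T) (a' *t b')
  = (a * a') *t (b * b').
Proof. exact: (tliftE (tmul_inner_l a b) (tmul_inner_r a b)). Qed.

Fact tmul_outer_l y (b : B) :
  linear (fun a : A => tlift (fun a' b' => (a * a') *t (b * b') : T) y).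
Proof.
move=> c u v; elim/tensor_ind: y => [|d a' b' y IHy].
  by rewrite !(linE (inner_linear _ _)) scaler0 addr0.
rewrite !(linE (inner_linear _ _)) !innerE IHy mulrDl -scalerAl tensPl.
by rewrite !scalerDr !scalerA mulrC addrACA.
Qed.

Fact tmul_outer_r y (a : A) :
  linear (fun b : B => tlift (fun a' b' => (a * a') *t (b * b') : T) y).
Proof.
move=> c u v; elim/tensor_ind: y => [|d a' b' y IHy].
  by rewrite !(linE (inner_linear _ _)) scaler0 addr0.
rewrite !(linE (inner_linear _ _)) !innerE IHy mulrDl -scalerAl tensPr.
by rewrite !scalerDr !scalerA mulrC addrACA.
Qed.

Lemma tmulPl y : linear (tmul^~ y).
Proof. exact: tlift_linear (tmul_outer_l y) (tmul_outer_r y). Qed.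

Lemma tmul_tens a b y :
  tmul (a *t b) y = tlift (fun a' b' => (a * a') *t (b * b')) y.
Proof. exact: (tliftE (tmul_outer_l y) (tmul_outer_r y)). Qed.

Lemma tmulE a b a' b' : tmul (a *t b) (a' *t b') = (a * a') *t (b * b').
Proof. by rewrite tmul_tens innerE. Qed.

Lemma tmulPr x : linear (tmul x).
Proof.
move=> c y z; elim/tensor_ind: x => [|d a b x IHx].
  by rewrite !(linE (tmulPl _)) scaler0 addr0.
rewrite !(linE (tmulPl _)) IHx !tmul_tens (linE (inner_linear _ _)).
by rewrite !scalerDr !scalerA mulrC addrACA.
Qed.

Fact tmulA : associative tmul.
Proof.
move=> x y z; elim/tensor_ind: x => [|d a b x IHx].
  by rewrite !(linE (tmulPl _)).
rewrite !(linE (tmulPl _)) IHx; congr (_ *: _ + _) => {x IHx}.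
elim/tensor_ind: y => [|e a' b' y IHy].
  by rewrite !(linE (tmulPl _)) !(linE (tmulPr _)) !(linE (tmulPl _)).
rewrite !(linE (tmulPl _)) !(linE (tmulPr _)) !(linE (tmulPl _)) IHy.
congr (_ *: _ + _) => {y IHy}.
elim/tensor_ind: z => [|f a'' b'' z IHz]; first by rewrite !(linE (tmulPr _)).
by rewrite !(linE (tmulPr _)) IHz !tmulE !mulrA.
Qed.

Fact tmul1l : left_id (1 *t 1) tmul.
Proof.
move=> x; elim/tensor_ind: x => [|d a b x IHx]; first by rewrite !(linE (tmulPr _)).
by rewrite !(linE (tmulPr _)) IHx tmulE !mul1r.
Qed.

Fact tmul1r : right_id (1 *t 1) tmul.
Proof.
move=> x; elim/tensor_ind: x => [|d a b x IHx]; first by rewrite !(linE (tmulPl _)).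
by rewrite !(linE (tmulPl _)) IHx tmulE !mulr1.
Qed.

Fact tmulDl : left_distributive tmul +%R.
Proof. by move=> x y z; rewrite -[x]scale1r (linE (tmulPl _)) !scale1r. Qed.

Fact tmulDr : right_distributive tmul +%R.
Proof. by move=> x y z; rewrite -[y]scale1r (linE (tmulPr _)) !scale1r. Qed.

HB.instance Definition _ :=
  GRing.Zmodule_isPzRing.Build T tmulA tmul1l tmul1r tmulDl tmulDr.

End TensorAlgebra.

HB.mixin Record Algebra_isBialgebra (k : fieldType) H of GRing.Algebra k H := {
  comul : {linear H -> tensor H H};
  counit : {lrmorphism H -> k^o};
  comulA : forall h : H, tassoc (tmap comul id (comul h)) = tmap id comul (comul h);
  comul_counitl : forall h : H, tlift (fun a b : H => counit a *: b) (comul h) = h;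
  comul_counitr : forall h : H, tlift (fun a b : H => counit b *: a) (comul h) = h;
  comul_monoid_morphism : monoid_morphism comul
}.

#[short(type="bialgType")]
HB.structure Definition Bialgebra (k : fieldType) :=
  {H of Algebra_isBialgebra k H & GRing.Algebra k H}.

HB.mixin Record Bialgebra_isHopf (k : fieldType) H of Bialgebra k H := {
  antipode : {linear H -> H};
  antipodel : forall h : H,
    tlift (fun a b : H => antipode a * b) (comul h) = counit h *: 1;
  antipoder : forall h : H,
    tlift (fun a b : H => a * antipode b) (comul h) = counit h *: 1
}.

#[short(type="hopfAlgType")]
HB.structure Definition HopfAlgebra (k : fieldType) :=
  {H of Bialgebra_isHopf k H & Bialgebra k H}.

(* Right H-modules are left modules over the opposite algebra H^c; MathComp
   provides H^c only as a ring. *)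

Section OppositeAlgebra.
Variables (k : fieldType) (A : algType k).

Definition conv_scale (a : k) (u : A^c) : A^c := a *: (u : A).
Fact conv_scaleA a b u : conv_scale a (conv_scale b u) = conv_scale (a * b) u.
Proof. exact: scalerA. Qed.
Fact conv_scale1 : left_id 1 conv_scale.
Proof. exact: scale1r. Qed.
Fact conv_scaleDr : right_distributive conv_scale +%R.
Proof. exact: scalerDr. Qed.
Fact conv_scaleDl u : {morph conv_scale^~ u : a b / a + b}.
Proof. by move=> a b; exact: scalerDl. Qed.
HB.instance Definition _ := GRing.Zmodule_isLmodule.Build k A^c
  conv_scaleA conv_scale1 conv_scaleDr conv_scaleDl.

Fact conv_scalerAl (a : k) (u v : A^c) : a *: (u * v : A^c) = (a *: u : A^c) * v.
Proof. exact: (@scalerAr k A a v u). Qed.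
Fact conv_scalerAr (a : k) (u v : A^c) : a *: (u * v : A^c) = u * (a *: v : A^c).
Proof. exact: (@scalerAl k A a v u). Qed.

HB.instance Definition _ := GRing.Lmodule_isLalgebra.Build k A^c conv_scalerAl.
HB.instance Definition _ := GRing.Lalgebra_isAlgebra.Build k A^c conv_scalerAr.

End OppositeAlgebra.

Section CounitOpposite.
Variables (k : fieldType) (H : bialgType k).

Definition counit_opp : H^c -> k^o := @counit k H.

Fact counit_opp_linear : linear counit_opp.
Proof. exact: (@linearP k H k^o _ (@counit k H)). Qed.
Fact counit_opp_monoid_morphism : monoid_morphism counit_opp.
Proof.
have e1 := rmorph1 (@counit k H); have eM := rmorphM (@counit k H).
by split=> [|x y]; [exact e1 | rewrite mulrC; exact (eM y x)].
Qed.

Definition counit_op : {lrmorphism H^c -> k^o} :=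
  HB.pack counit_opp
    (GRing.isLinear.Build k H^c k^o _ counit_opp counit_opp_linear)
    (GRing.isMonoidMorphism.Build H^c k^o counit_opp counit_opp_monoid_morphism).

End CounitOpposite.

(* The one-dimensional module on which A acts through e : A -> k. *)

Section TrivialModule.
Variables (k : fieldType) (A : algType k) (e : {lrmorphism A -> k^o}).

Definition triv_mod of {lrmorphism A -> k^o} : Type := k.
Local Notation M := (triv_mod e).
HB.instance Definition _ := GRing.Zmodule.copy M k.

Definition triv_scale (a : A) (x : M) : M := (e a : k) * (x : k).
Fact triv_scaleA a b x : triv_scale a (triv_scale b x) = triv_scale (a * b) x.
Proof. by rewrite /triv_scale rmorphM mulrA. Qed.
Fact triv_scale1 : left_id 1 triv_scale.
Proof. by move=> x; rewrite /triv_scale rmorph1 mul1r. Qed.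
Fact triv_scaleDr : right_distributive triv_scale +%R.
Proof. by move=> a x y; rewrite /triv_scale mulrDr. Qed.
Fact triv_scaleDl x : {morph triv_scale^~ x : a b / a + b}.
Proof. by move=> a b; rewrite /triv_scale rmorphD mulrDl. Qed.
HB.instance Definition _ := GRing.Zmodule_isLmodule.Build A M
  triv_scaleA triv_scale1 triv_scaleDr triv_scaleDl.

End TrivialModule.

Section Resolutions.
Variable R : nzRingType.
Implicit Types M P N : lmodType R.

Definition is_surj (X Y : Type) (f : X -> Y) : Prop := forall y, exists x, f x = y.

Definition projective P : Prop :=
  forall M N (g : {linear M -> N}) (f : {linear P -> N}),
    is_surj g -> exists h : {linear P -> M}, forall p, g (h p) = f p.

Definition finitely_generated M : Prop :=
  exists (n : nat) (x : 'I_n -> M),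
    forall y, exists c : 'I_n -> R, y = \sum_i c i *: x i.

(* ... -> P_2 -> P_1 -> P_0 -> M -> 0, with res_d n : P_(n+1) -> P_n. *)
Record resolution M := Resolution {
  res_obj :> nat -> lmodType R;
  res_aug : {linear res_obj 0 -> M};
  res_d : forall n, {linear res_obj n.+1 -> res_obj n};
  res_aug_surj : is_surj res_aug;
  res_exact0 : forall x, res_aug x = 0 <-> exists y, res_d 0 y = x;
  res_exact : forall n x, res_d n x = 0 <-> exists y, res_d n.+1 y = x
}.

Definition has_fg_projective_resolution M : Prop :=
  exists P : resolution M, forall n, projective (P n) /\ finitely_generated (P n).

End Resolutions.

(* Every module M is a quotient of the free module on its underlying set; the
   standard free resolution of M iterates this on the successive kernels. *)

Section Kernel.
Variables (R : nzRingType) (M N : lmodType R) (f : {linear M -> N}).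

Definition ker_pred of {linear M -> N} := fun x : M => f x == 0.
Fact ker_closed : submod_closed (ker_pred f).
Proof.
by split=> [|a x y]; rewrite !unfold_in ?linear0 // linearP => /eqP-> /eqP->;
   rewrite scaler0 addr0.
Qed.
HB.instance Definition _ := GRing.isSubmodClosed.Build R M (ker_pred f) ker_closed.

Record kermod := Ker { ker_val : M; ker_valP : ker_pred f ker_val }.
HB.instance Definition _ := [isSub for ker_val].
HB.instance Definition _ := [Choice of kermod by <:].
HB.instance Definition _ := [SubChoice_isSubLmodule of kermod by <:].

End Kernel.

Section FreeResolution.
Variables (R : nzRingType) (M : lmodType R).

Definition free_cover (N : lmodType R) : {linear {freeg N / R} -> N} :=
  fglift id.

Fixpoint syzygy (n : nat) : lmodType R :=
  if n is m.+1 then kermod (free_cover (syzygy m)) else M.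

Definition std_obj (n : nat) : lmodType R := {freeg (syzygy n) / R}.
Definition std_aug : {linear std_obj 0 -> M} := free_cover M.
Definition std_d (n : nat) : {linear std_obj n.+1 -> std_obj n} :=
  (val : kermod (free_cover (syzygy n)) -> std_obj n) \o free_cover (syzygy n.+1).


Lemma free_cover_surj N : is_surj (free_cover N).
Proof. by move=> y; exists << y >>; rewrite /= liftU scale1r. Qed.

Fact std_aug_surj : is_surj std_aug.
Proof. exact: free_cover_surj. Qed.

Lemma ker_val_eq0 n (x : kermod (free_cover (syzygy n))) : val x = 0 -> x = 0.
Proof. by move=> x0; apply: val_inj; rewrite x0 raddf0. Qed.

Lemma free_cover_ker n (x : std_obj n) :
  free_cover (syzygy n) x = 0 <-> exists y, std_d n y = x.
Proof.
split=> [/eqP x0|[y <-]]; last exact/eqP/(valP (free_cover (syzygy n.+1) y)).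
have [y yx] := @free_cover_surj (syzygy n.+1) (Ker x0).
by exists y; rewrite /std_d /= yx.
Qed.

Fact std_exact0 x : std_aug x = 0 <-> exists y, std_d 0 y = x.
Proof. exact: (@free_cover_ker 0). Qed.

Fact std_exact n x : std_d n x = 0 <-> exists y, std_d n.+1 y = x.
Proof.
rewrite -free_cover_ker /std_d /=; split=> [|->]; last by [].
exact: ker_val_eq0.
Qed.

Definition std_resolution : resolution M :=
  Resolution std_aug_surj std_exact0 std_exact.

Lemma free_projective (K : choiceType) : projective {freeg K / R}.
Proof.
move=> X N g f /= g_surj.
have [s sE] := choice (fun x : K => g_surj (f << x >>)).
exists (fglift s) => p; rewrite -[p]freeg_sumE !linear_sum.
apply: eq_bigr => x _ /=; rewrite liftU linearZ /= sE -linearZ /=; congr (f _).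
by apply/eqP/freeg_eqP => y; rewrite coeffZ !coeffU mul1r.
Qed.

Lemma std_resolution_projective n : projective (std_resolution n).
Proof. exact: free_projective. Qed.

End FreeResolution.

(* Hom_A(P, N) as a k-space: the scalar a acts on N as a *: 1 in A, which is
   central. *)

Section HomSpace.
Variables (k : fieldType) (A : algType k) (P N : lmodType A).

Definition modhom : Type := {linear P -> N}.
Definition hom_fun (f : modhom) : {linear P -> N} := f.
Local Coercion hom_fun : modhom >-> GRing.Linear.type.
HB.instance Definition _ := gen_eqMixin modhom.
HB.instance Definition _ := gen_choiceMixin modhom.
Implicit Types f g h : modhom.

Lemma homP f g : (forall x, f x = g x) -> f = g.
Proof.
case: f => f [[f0] [fD]] /=; case: g => g [[g0] [gD]] /= /funext fg; case: _ / fg g0 gD => g0 gD.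
by rewrite (Prop_irrelevance g0 f0) (Prop_irrelevance gD fD).
Qed.

Definition hom0 : modhom := (\0 : {linear P -> N}).
Definition hom_opp f : modhom := (\- f : {linear P -> N}).
Definition hom_add f g : modhom := (f \+ g : {linear P -> N}).

Fact hom_scale_linear (a : k) f : linear (fun p : P => a%:A *: f p).
Proof.
by move=> b u v; rewrite linearP scalerDr !scalerA mulr_algl mulr_algr.
Qed.
Definition hom_scale (a : k) f : modhom :=
  HB.pack (fun p : P => a%:A *: f p)
    (GRing.isLinear.Build A P N _ _ (hom_scale_linear a f)).

Fact hom_addA : associative hom_add.
Proof. by move=> f g h; apply: homP => x; apply: addrA. Qed.
Fact hom_addC : commutative hom_add.
Proof. by move=> f g; apply: homP => x; apply: addrC. Qed.
Fact hom_add0 : left_id hom0 hom_add.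
Proof. by move=> f; apply: homP => x; apply: add0r. Qed.
Fact hom_addN : left_inverse hom0 hom_opp hom_add.
Proof. by move=> f; apply: homP => x; apply: addNr. Qed.
HB.instance Definition _ :=
  GRing.isZmodule.Build modhom hom_addA hom_addC hom_add0 hom_addN.

Fact hom_scaleA a b f : hom_scale a (hom_scale b f) = hom_scale (a * b) f.
Proof. by apply: homP => x /=; rewrite scalerA mulr_algl scalerA. Qed.
Fact hom_scale1 : left_id 1 hom_scale.
Proof. by move=> f; apply: homP => x /=; rewrite !scale1r. Qed.
Fact hom_scaleDr : right_distributive hom_scale +%R.
Proof. by move=> a f g; apply: homP => x; apply: scalerDr. Qed.
Fact hom_scaleDl f : {morph hom_scale^~ f : a b / a + b}.
Proof. by move=> a b; apply: homP => x /=; rewrite !scalerDl. Qed.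
HB.instance Definition _ := GRing.Zmodule_isLmodule.Build k modhom
  hom_scaleA hom_scale1 hom_scaleDr hom_scaleDl.

End HomSpace.

Coercion hom_fun : modhom >-> GRing.Linear.type.

Section HomComp.
Variables (k : fieldType) (A : algType k) (P Q N : lmodType A).
Variable d : {linear Q -> P}.

Definition hom_comp (f : modhom P N) : modhom Q N := (f \o d : {linear Q -> N}).

Fact hom_comp_linear : linear hom_comp.
Proof. by move=> a f g; apply: homP. Qed.
HB.instance Definition _ := GRing.isLinear.Build k (modhom P N) (modhom Q N) _
  hom_comp hom_comp_linear.

End HomComp.

(* Ext_A^n(M, N) is the cohomology of the complex Hom_A(P_n, N), where P is the
   standard free resolution of M; by the comparison theorem any projective
   resolution gives the same k-spaces up to isomorphism. *)

Section Ext.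
Variables (k : fieldType) (A : algType k) (M N : lmodType A).

Section ResolutionCohomology.
Variable P : resolution M.

Definition cocycle (n : nat) : lmodType k :=
  kermod (hom_comp (N := N) (res_d P n) : {linear modhom (P n) N -> modhom (P n.+1) N}).

Definition coboundary (n : nat) : cocycle n -> Prop :=
  match n with
  | 0 => fun z => z = 0
  | m.+1 => fun z => exists f : modhom (P m) N, val z = hom_comp (res_d P m) f
  end.

Fact coboundary_submodule n : is_submodule (@coboundary n).
Proof.
case: n => [|n]; split=> //=.
- by move=> a u v -> ->; rewrite scaler0 addr0.
- by exists 0; rewrite linear0.
- by move=> a u v [f fu] [g gv]; exists (a *: f + g); rewrite linearP /= fu gv.
Qed.

Definition res_ext (n : nat) : lmodType k := quotmod (@coboundary_submodule n).

End ResolutionCohomology.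

Definition Ext (n : nat) : lmodType k := res_ext (std_resolution M) n.

End Ext.

Definition has_dim (k : fieldType) (V : lmodType k) (n : nat) : Prop :=
  exists2 f : V -> 'rV[k]_n, linear f & bijective f.

Definition regular_elt (R : nzRingType) (x : R) : Prop := GRing.lreg x /\ GRing.rreg x.

Definition ltriv (k : fieldType) (H : bialgType k) : lmodType H :=
  triv_mod (@counit k H).
Definition rtriv (k : fieldType) (H : bialgType k) : lmodType H^c :=
  triv_mod (@counit_op k H).

(* Main.v *)
(** Write S for the antipode and D for Ext^i_{H^e}(H, H (x) H). Both
[M |-> M (x) H] (from left modules) and its mirror image (from right modules)
turn a projective resolution of the trivial module into a projective resolution
of the bimodule H, so D can be computed from either side. When Ext^i_H(k, H) is
one-dimensional with character al, the left computation gives D = H with inner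
actions m |-> y m T(x), where T(x) = sum al(x_1) S(S(x_2)); the right computation
shows that D is a nonzero faithful module for the action of x. Hence T, and then
S, is injective. When both sides are one-dimensional, comparing the two
descriptions gives a bijection Theta of H with Theta(y m T(x)) = T'(y) Theta(m) x;
then g = Theta(1) is left invertible, c = Theta^{-1}(1) is right invertible, and
H = T'(H) g = c T(H), so regularity of g or of c makes S surjective. *)

Require Import Defs.
From HB Require Import structures.
From mathcomp Require Import all_boot all_algebra.
From mathcomp Require Import boolp classical_sets.

Set Implicit Arguments.
Unset Strict Implicit.
Unset Printing Implicit Defensive.

Import GRing.Theory.

Local Open Scope ring_scope.

(** * The comparison theorem for modules over a set of operators *)

(** Since S need not be invertible, only S and its powers may occur in formulas. The adjoint module
    of H (x) H can nevertheless be untwisted: the map h (x) w -> h_1 (x) w S(h_2) has the inverse a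
    (x) b -> a_1 (x) b S(S(a_2)), and this is the origin of the square of S in T. Identifying D with
    H requires Ext to commute with an infinite direct sum of copies of H, and this is where finitely
    generated projectives enter. The hypothesis concerns one side, while the argument needs the
    conclusion on both, so it is recast as an approximation property of cocycle classes that
    survives the passage between left and right modules. The winding by the character al is onto, so
    a kernel of S would show up as a kernel of T. No cohomology space with values in a bimodule is
    formed: cocycles are handled modulo coboundaries, through transfer maps natural in the
    coefficients, and naturality is what carries the inner actions from one side to the other. *)

Section OperatorModules.
Variable I : Type.

(* Left modules over a ring [R] are treated with [I = R], bimodules over an
   algebra [A] with [I = A * A], the pair (a, b) acting as x |-> a x b. *)
Record opmod := OpMod {
  ocar :> zmodType;
  oact : I -> ocar -> ocar;
  oactB : forall i x y, oact i (x - y) = oact i x - oact i y }.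

Implicit Types X Y Z : opmod.

Definition omor (X Y : opmod) (f : X -> Y) : Prop :=
  (forall x y, f (x - y) = f x - f y) /\ (forall i x, f (oact i x) = oact i (f x)).

Lemma omor0 X Y (f : X -> Y) : omor f -> f 0 = 0.
Proof. by case=> fB _; rewrite -(subrr 0) fB subrr. Qed.

Lemma omorD X Y (f : X -> Y) : omor f -> forall x y, f (x + y) = f x + f y.
Proof.
move=> fm x y; have [fB _] := fm.
by rewrite -[y in LHS]opprK fB -[- y]sub0r fB omor0 // sub0r opprK.
Qed.

Lemma omor_comp X Y Z (g : Y -> Z) (f : X -> Y) :
  omor g -> omor f -> omor (fun x => g (f x)).
Proof. by move=> [gB ga] [fB fa]; split=> *; rewrite ?fB ?gB ?fa ?ga. Qed.

Lemma omor_sub X Y (f g : X -> Y) : omor f -> omor g -> omor (fun x => f x - g x).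
Proof.
move=> [fB fa] [gB ga]; split=> [x y|i x]; last by rewrite fa ga oactB.
by rewrite fB gB !opprB addrACA [RHS]addrACA [- f y - _]addrC.
Qed.

Lemma omor_zero X Y : omor (fun _ : X => 0 : Y).
Proof. by split=> [x y|i x]; rewrite ?subrr // -[in RHS](subrr 0) oactB subrr. Qed.

Lemma omor_id X : omor (fun x : X => x).
Proof. by []. Qed.

(* A resolution together with its augmentation: the resolved module has index 0
   and the term of homological degree n has index n.+1. *)
Record acyclic := Acyclic {
  aobj :> nat -> opmod;
  ad_ : forall n, aobj n.+1 -> aobj n;
  ad_mor : forall n, omor (@ad_ n);
  ad_surj : is_surj (@ad_ 0);
  ad_exact : forall n x, ad_ x = 0 <-> exists y, @ad_ n.+1 y = x }.

Lemma ad_ad (A : acyclic) n (x : A n.+2) : ad_ (ad_ x) = 0.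
Proof. by apply/ad_exact; exists x. Qed.

(** Projectivity of the terms of [A], relative to [B]: the first clause is used at the augmentation,
    the second at the exact spots. As a condition on a pair it can be checked for bimodules through
    the induction adjunction. *)
Definition lifting (A B : acyclic) : Prop := forall n,
  (forall f : A n.+1 -> B 0, omor f ->
     exists2 h : A n.+1 -> B 1, omor h & forall x, ad_ (h x) = f x) /\
  (forall m (f : A n.+1 -> B m.+1), omor f -> (forall x, ad_ (f x) = 0) ->
     exists2 h : A n.+1 -> B m.+2, omor h & forall x, ad_ (h x) = f x).

Definition cocyc (A : acyclic) n (X : opmod) (f : A n.+1 -> X) : Prop :=
  omor f /\ forall x, f (ad_ x) = 0.

(** In homological degree 0 only the zero map counts: a map factoring through the augmentation onto
    [A 0] is a cocycle, not a coboundary. *)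
Definition cobd (A : acyclic) n (X : opmod) : (A n.+1 -> X) -> Prop :=
  match n with
  | 0 => fun f => forall x, f x = 0
  | m.+1 => fun f => exists2 g : A m.+1 -> X, omor g & forall x, f x = g (ad_ x)
  end.

Section CohomologyRelation.
Variables (A : acyclic) (n : nat).

Lemma cobd_comp X Y (t : X -> Y) (f : A n.+1 -> X) :
  omor t -> cobd f -> cobd (fun x => t (f x)).
Proof.
case: n f => [|m] f tm /=; first by move=> f0 x; rewrite f0 omor0.
by case=> g gm fg; exists (fun x => t (g x)); [exact: omor_comp | move=> x; rewrite fg].
Qed.

Lemma cocyc_comp X Y (t : X -> Y) (f : A n.+1 -> X) :
  omor t -> cocyc f -> cocyc (fun x => t (f x)).
Proof.
by move=> tm [fm f0]; split=> [|x]; [exact: omor_comp | rewrite f0 omor0].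
Qed.

Lemma cobd_sub X (f g : A n.+1 -> X) :
  cobd f -> cobd g -> cobd (fun x => f x - g x).
Proof.
case: n f g => [|m] f g /=; first by move=> f0 g0 x; rewrite f0 g0 subrr.
case=> f' f'm ff' [g' g'm gg']; exists (fun x => f' x - g' x); first exact: omor_sub.
by move=> x; rewrite ff' gg'.
Qed.

Lemma cobd_ext X (f g : A n.+1 -> X) : (forall x, f x = g x) -> cobd f -> cobd g.
Proof. by move=> /funext ->. Qed.

Lemma cobd_zero X : cobd (fun _ : A n.+1 => 0 : X).
Proof.
case: n => [|m] //=.
by exists (fun _ => 0); [exact: omor_zero | ].
Qed.

Lemma cobd_opp X (f : A n.+1 -> X) : cobd f -> cobd (fun x => - f x).
Proof.
by move=> f0; apply: cobd_ext (cobd_sub (cobd_zero X) f0) => x; rewrite sub0r.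
Qed.

Lemma cobd_add X (f g : A n.+1 -> X) : cobd f -> cobd g -> cobd (fun x => f x + g x).
Proof.
by move=> f0 /cobd_opp g0; apply: cobd_ext (cobd_sub f0 g0) => x; rewrite opprK.
Qed.

Lemma cobd_sum X (J : Type) (s : seq J) (f : J -> A n.+1 -> X) :
  (forall j, cobd (f j)) -> cobd (fun x => \sum_(j <- s) f j x).
Proof.
move=> f0; elim: s => [|j s IHs].
  by apply: cobd_ext (cobd_zero X) => x; rewrite big_nil.
by apply: cobd_ext (cobd_add (f0 j) IHs) => x; rewrite big_cons.
Qed.

End CohomologyRelation.

(** * Chain maps over a given map, and their homotopies *)

Section ChainMaps.
Variables (A B : acyclic) (u0 : A 0 -> B 0).

(** Says that one component extends downwards to a morphism of complexes over [u0]. Keeping the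
    lower components existential avoids choosing a whole sequence at once. *)
Fixpoint chainmap n : (A n -> B n) -> Prop :=
  match n return (A n -> B n) -> Prop with
  | 0 => fun f => forall x, f x = u0 x
  | m.+1 => fun f => omor f /\
      exists2 f' : A m -> B m, chainmap f' & forall x, ad_ (f x) = f' (ad_ x)
  end.

Lemma chainmap_mor n (f : A n -> B n) : omor u0 -> chainmap f -> omor f.
Proof. by case: n f => [|n] f u0m /= => [/funext ->|[]]. Qed.

Lemma chainmap_exists n : omor u0 -> lifting A B ->
  forall f : A n -> B n, chainmap f ->
    exists g : A n.+1 -> B n.+1, omor g /\ forall x, ad_ (g x) = f (ad_ x).
Proof.
move=> u0m AB f cf; have fdm : omor (fun x : A n.+1 => f (ad_ x)).
  exact: omor_comp (chainmap_mor u0m cf) (@ad_mor A n).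
have [L0 LS] := AB n.
case: n f cf fdm L0 LS => [|n] f cf fdm L0 LS.
  by have [h hm hE] := L0 _ fdm; exists h.
have [|h hm hE] := LS _ _ fdm; last by exists h.
move=> x; case: cf => _ [f' cf' ->]; rewrite ad_ad omor0 //.
exact: chainmap_mor cf'.
Qed.

Lemma chainmap_total n : omor u0 -> lifting A B -> exists f : A n -> B n, chainmap f.
Proof.
move=> u0m AB; elim: n => [|n [f cf]]; first by exists u0.
by have [g [gm gE]] := chainmap_exists u0m AB cf; exists g; split=> //; exists f.
Qed.

Lemma chainmap_cocyc X n (u : A n.+1 -> B n.+1) (f : B n.+1 -> X) :
  omor u0 -> lifting A B -> chainmap u -> cocyc f -> cocyc (fun x => f (u x)).
Proof.
move=> u0m AB cu [fm f0]; have um := chainmap_mor u0m cu.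
split=> [|x]; first exact: omor_comp.
by have [u' [u'm u'E]] := chainmap_exists u0m AB cu; rewrite -u'E f0.
Qed.

Lemma chainmap_cobd X n (u : A n.+1 -> B n.+1) (f : B n.+1 -> X) :
  omor u0 -> chainmap u -> cobd f -> cobd (fun x => f (u x)).
Proof.
move=> u0m; case: n u f => [|n] u f /=; first by move=> _ f0 x; exact: f0.
case=> um [u' cu' u'E] [g gm gE]; exists (fun x => g (u' x)).
  by apply: omor_comp gm _; case: cu'.
by move=> x; rewrite gE u'E.
Qed.

End ChainMaps.

Lemma chainmap_comp (A B C : acyclic) (u0 : A 0 -> B 0) (v0 : B 0 -> C 0) n
    (u : A n -> B n) (v : B n -> C n) : omor u0 -> omor v0 ->
  chainmap u0 u -> chainmap v0 v -> chainmap (fun x => v0 (u0 x)) (fun x => v (u x)).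
Proof.
move=> u0m v0m; elim: n u v => [|n IHn] u v /=; first by move=> uE vE x; rewrite vE uE.
case=> um [u' cu' uE] [vm [v' cv' vE]]; split; first exact: omor_comp.
by exists (fun x => v' (u' x)); [exact: IHn | move=> x; rewrite vE uE].
Qed.

(** By induction, the defect w - id - t d is killed by the differential, hence lifts to d s. The
    homotopy is required to vanish on the resolved module because in degree 0 a map through [A 0]
    would not be a coboundary. *)
Lemma chainmap_homotopy (A : acyclic) n (w : A n -> A n) :
  lifting A A -> chainmap (fun x => x) w ->
  exists2 s : A n -> A n.+1, omor s /\ (n = 0%N -> forall x, s x = 0) &
    match n return (A n -> A n) -> (A n -> A n.+1) -> Prop with
    | 0 => fun w s => forall x, w x = x
    | m.+1 => fun w s => exists2 t : A m -> A m.+1,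
        omor t /\ (m = 0%N -> forall x, t x = 0) &
        forall x, w x - x = ad_ (s x) + t (ad_ x)
    end w s.
Proof.
move=> AA; elim: n w => [|n IHn] w /=.
  by move=> wE; exists (fun _ => 0) => //; split=> //; exact: omor_zero.
case=> wm [w' cw' wE]; have [t [tm t0] tE] := IHn _ cw'.
pose f (x : A n.+1) := w x - x - t (ad_ x).
have fm : omor f.
  apply: omor_sub; first by apply: omor_sub wm _; exact: omor_id.
  exact: omor_comp tm (@ad_mor A n).
have [_ LS] := AA n; have [|s sm sE] := LS _ f fm.
  move=> x; have [dB _] := @ad_mor A n; rewrite /f !dB wE.
  case: n w' w {IHn LS f fm wm cw'} t tm t0 tE x wE dB => [|n] w' w t tm t0 tE x wE dB.
    by rewrite tE subrr t0 // omor0 ?subrr //; exact: ad_mor.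
  have [t' [t'm t'0] t'E] := tE; rewrite t'E ad_ad (omor0 t'm) addr0 subrr //.
exists s; first by split.
by exists t => // x; rewrite sE /f subrK.
Qed.

Lemma chainmap_id_cobd (A : acyclic) X n (w : A n.+1 -> A n.+1) (f : A n.+1 -> X) :
  lifting A A -> chainmap (fun x => x) w -> cocyc f ->
  cobd (fun x => f (w x) - f x).
Proof.
move=> AA /(chainmap_homotopy AA) [s [sm _] [t [tm t0] wE]] [fm f0].
have fE x : f (w x) - f x = f (t (ad_ x)).
  by have [fB _] := fm; rewrite -fB wE omorD // f0 add0r.
case: n w s t sm tm t0 wE f fm {f0} fE => [|n] w s t sm tm t0 wE f fm fE /=.
  by move=> x; rewrite fE t0 // omor0.
by exists (fun x => f (t x)) => //; exact: omor_comp.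
Qed.

(** The maps [u] and [v] are fixed before the coefficients [X]; this is what later makes the
    transfer of cocycles natural in [X]. *)
Theorem comparison (A B : acyclic) (u0 : A 0 -> B 0) (v0 : B 0 -> A 0) :
  omor u0 -> omor v0 -> cancel u0 v0 -> cancel v0 u0 ->
  lifting A A -> lifting A B -> lifting B A -> lifting B B ->
  forall n, exists (u : A n.+1 -> B n.+1) (v : B n.+1 -> A n.+1),
  [/\ omor u /\ omor v,
      forall X (f : B n.+1 -> X), (cocyc f -> cocyc (fun x => f (u x))) /\
                                  (cobd f -> cobd (fun x => f (u x))),
      forall X (f : A n.+1 -> X), (cocyc f -> cocyc (fun x => f (v x))) /\
                                  (cobd f -> cobd (fun x => f (v x))),
      forall X (f : A n.+1 -> X), cocyc f -> cobd (fun x => f (v (u x)) - f x) &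
      forall X (f : B n.+1 -> X), cocyc f -> cobd (fun x => f (u (v x)) - f x)].
Proof.
move=> u0m v0m uK vK AA AB BA BB n.
have [u cu] := chainmap_total n.+1 u0m AB; have [v cv] := chainmap_total n.+1 v0m BA.
exists u, v; split.
- by split; [exact: chainmap_mor u0m cu | exact: chainmap_mor v0m cv].
- by move=> X f; split; [exact: chainmap_cocyc u0m AB cu | exact: chainmap_cobd u0m cu].
- by move=> X f; split; [exact: chainmap_cocyc v0m BA cv | exact: chainmap_cobd v0m cv].
- move=> X f; apply: (@chainmap_id_cobd A X n (fun x => v (u x))) => //.
  have -> : (fun x => x) = (fun x => v0 (u0 x)) by apply/funext => x; rewrite uK.
  exact: chainmap_comp u0m v0m cu cv.
- move=> X f; apply: (@chainmap_id_cobd B X n (fun x => u (v x))) => //.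
  have -> : (fun x => x) = (fun x => u0 (v0 x)) by apply/funext => x; rewrite vK.
  exact: chainmap_comp v0m u0m cv cu.
Qed.

End OperatorModules.

(** * Linear functionals and operators of finite rank *)

Section Functionals.
Variables (k : fieldType) (V : lmodType k).
Implicit Types S : V -> Prop.

Lemma submodD S u v : is_submodule S -> S u -> S v -> S (u + v).
Proof. by case=> _ SP Su Sv; rewrite -[u]scale1r; exact: SP. Qed.

Lemma submodZ S a u : is_submodule S -> S u -> S (a *: u).
Proof. by case=> S0 SP Su; rewrite -[_ *: _]addr0; exact: SP. Qed.

Lemma submodB S u v : is_submodule S -> S u -> S v -> S (u - v).
Proof. by move=> SS Su Sv; apply: submodD => //; rewrite -scaleN1r; exact: submodZ. Qed.

Lemma functional_exists S v : is_submodule S -> ~ S v ->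
  exists2 f : {linear V -> k^o}, (forall u, S u -> f u = 0) & f v = 1.
Proof.
(* [A] need only become a submodule after adding [S], so that the empty set, the union of the empty
   chain, is admissible. *)
move=> SS Sv; pose P (A : set V) := is_submodule (A `|` S)%classic /\ ~ (A `|` S)%classic v.
have [|A [[AS Av] Amax]] := @Zorn_bigcup V P.
  move=> F FP totF; split; last first.
    by case=> [[X FX Xv]|//]; have [_ []] := FP _ FX; left.
  split; first by right; case: SS.
  have mem1 X : F X -> is_submodule (X `|` S)%classic by move=> /FP[].
  have sub X : F X -> forall w, (X `|` S)%classic w -> (\bigcup_(X in F) X `|` S)%classic w.
    by move=> FX w [Xw|Sw]; [left; exists X | right].
  move=> a w w' [[X FX Xw]|Sw] [[Y FY Yw]|Sw'].
  - have [XY|YX] := totF _ _ FX FY.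
      by apply: (sub Y FY); case: (mem1 _ FY) => _; apply; left=> //; exact: XY.
    by apply: (sub X FX); case: (mem1 _ FX) => _; apply; left=> //; exact: YX.
  - by apply: (sub X FX); case: (mem1 _ FX) => _; apply; [left | right].
  - by apply: (sub Y FY); case: (mem1 _ FY) => _; apply; [right | left].
  - by right; case: SS => _; apply.
set W := (A `|` S)%classic in AS Av.
(* By maximality [W] is a complement of the line through [v], and the functional is the coordinate
   along [v]: if u is outside [W], then [W] enlarged by u contains [v]. *)
have dec u : exists c : k, W (u - c *: v).
  have [Wu|Wu] := pselect (W u); first by exists 0; rewrite scale0r subr0.
  pose B : set V := fun x => exists c, W (x - c *: u).
  have BS : is_submodule (B `|` S)%classic.
    have -> : (B `|` S)%classic = B.
      apply/predeqP => x; split=> [[//|Sx]|]; last by left.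
      by exists 0; rewrite scale0r subr0; right.
    split; first by exists 0; rewrite scale0r subr0; case: AS.
    move=> a x y [c Wx] [d Wy]; exists (a * c + d).
    have -> : a *: x + y - (a * c + d) *: u = a *: (x - c *: u) + (y - d *: u).
      by rewrite scalerBr scalerA scalerDl opprD addrACA.
    by case: AS => _; apply.
  have AB : (A `<` B)%classic.
    split; last by move=> BA; apply: Wu; left; apply: BA; exists 1; rewrite scale1r subrr; case: AS.
    by move=> x Ax; exists 0; rewrite scale0r subr0; left.
  have : ~ P B by exact: Amax.
  have [Bv|Bv] := pselect ((B `|` S)%classic v); last by case; split.
  move=> _; case: Bv => [[c Wc]|//].
  have [c0|c0] := eqVneq c 0; first by case: Av; move: Wc; rewrite c0 scale0r subr0.
  exists c^-1; rewrite -[_ - _]opprK opprB -[v](subrK (c *: u)) scalerDr scalerA mulVf //.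
  rewrite scale1r addrK -scaleN1r; apply: submodZ => //; exact: submodZ.
have uniq c d u : W (u - c *: v) -> W (u - d *: v) -> c = d.
  move=> Wc Wd; apply/eqP/negP => /negP cd; apply: Av.
  have d0 : d - c != 0 by rewrite subr_eq0 eq_sym.
  rewrite -[v]scale1r -(mulVf d0) -scalerA; apply: submodZ => //.
  have -> : (d - c) *: v = (u - c *: v) - (u - d *: v).
    by rewrite opprB [RHS]addrC addrA subrK scalerBl.
  exact: submodB.
have [f fP] := choice dec; have fl : linear (f : V -> k^o).
  move=> a x y; apply: (uniq _ _ _ (fP _)).
  have -> : a *: x + y - (a *: (f x : k^o) + f y) *: v = a *: (x - f x *: v) + (y - f y *: v).
    by rewrite scalerBr scalerA scalerDl opprD addrACA.
  by case: AS => _; apply.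
pose F : {linear V -> k^o} := 
  HB.pack (f : V -> k^o) (GRing.isLinear.Build k V k^o _ (f : V -> k^o) fl).
exists F => [u Su|] /=.
  by apply: (uniq _ _ _ (fP _)); rewrite scale0r subr0; right.
by apply: (uniq _ _ _ (fP _)); rewrite scale1r subrr; case: AS.
Qed.

Lemma functional_neq0 (v : V) : v != 0 -> exists f : {linear V -> k^o}, f v = 1.
Proof.
move=> v0; have [||f _ fv] := @functional_exists (fun u => u = 0) v; last by exists f.
- by split=> // a u w -> ->; rewrite scaler0 addr0.
- exact/eqP.
Qed.

Definition fin_rank (s : seq ({linear V -> k^o} * V)) (x : V) : V :=
  \sum_(p <- s) (p.1 x : k) *: p.2.

Lemma fin_rank_linear s : linear (fin_rank s).
Proof.
move=> a x y; rewrite /fin_rank scaler_sumr -big_split /=; apply: eq_bigr => p _.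
by rewrite linearP scalerDl scalerA.
Qed.

(** A functional that vanishes on the vectors already fixed and takes the value 1 at [v] corrects
    the operator at [v] without disturbing them. These operators stand in for a basis of a possibly
    infinite-dimensional space. *)
Lemma fin_rank_approx (l : seq V) : exists s, {in l, forall v, fin_rank s v = v}.
Proof.
elim: l => [|v l [s sE]]; first by exists [::].
have fl := fin_rank_linear s.
pose S x := fin_rank s x = x.
have SS : is_submodule S.
  by rewrite /S; split=> [|a x y Sx Sy]; rewrite ?(linE fl) ?Sx ?Sy.
have [Sv|Sv] := pselect (S v).
  by exists s => // x; rewrite inE => /orP[/eqP-> //|]; exact: sE.
have [f fS fv] := functional_exists SS Sv.
exists ((f, v - fin_rank s v) :: s) => x.
rewrite /fin_rank big_cons /= -/(fin_rank s x) inE => /orP[/eqP->|xl].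
  by rewrite fv scale1r subrK.
have Sx := sE _ xl; by rewrite (fS x) // scale0r add0r.
Qed.

End Functionals.

(** * Linear maps on tensor products and Sweedler sums *)

Section LinearFunctions.
Variable k : fieldType.
Implicit Types (U V W : lmodType k) (A : algType k).

Lemma lin_id U : linear (fun x : U => x).
Proof. by []. Qed.

Lemma lin_mull U A (f : U -> A) c : linear f -> linear (fun x => f x * c).
Proof. by move=> lf a x y; rewrite lf mulrDl scalerAl. Qed.

Lemma lin_mulr U A (f : U -> A) c : linear f -> linear (fun x => c * f x).
Proof. by move=> lf a x y; rewrite lf mulrDr scalerAr. Qed.

Lemma lin_scalel U V (f : U -> k^o) (v : V) : linear f -> linear (fun x => (f x : k) *: v).
Proof. by move=> lf a x y; rewrite lf scalerDl scalerA. Qed.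

Lemma lin_scaler U V (f : U -> V) (c : k) : linear f -> linear (fun x => c *: f x).
Proof. by move=> lf a x y; rewrite lf scalerDr !scalerA mulrC. Qed.

Lemma lin_tensl U V W (f : U -> V) (w : W) : linear f -> linear (fun x => f x *t w).
Proof. by move=> lf a x y; rewrite lf tensPl. Qed.

Lemma lin_tensr U V W (f : U -> V) (w : W) : linear f -> linear (fun x => w *t f x).
Proof. by move=> lf a x y; rewrite lf tensPr. Qed.

Lemma lin_app U V W (g : {linear V -> W}) (f : U -> V) : linear f -> linear (fun x => g (f x)).
Proof. by move=> lf a x y; rewrite lf linearP. Qed.

Lemma lin_comp U V W (g : V -> W) (f : U -> V) :
  linear g -> linear f -> linear (fun x => g (f x)).
Proof. by move=> lg lf a x y; rewrite lf lg. Qed.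

Lemma lin_add U V (f g : U -> V) : linear f -> linear g -> linear (fun x => f x + g x).
Proof. by move=> lf lg a x y; rewrite lf lg scalerDr addrACA. Qed.

Lemma lin_sum U V (J : Type) (s : seq J) (F : J -> U -> V) :
  (forall j, linear (F j)) -> linear (fun x => \sum_(j <- s) F j x).
Proof.
move=> lF a x y; rewrite scaler_sumr -big_split; apply: eq_bigr => j _ /=.
exact: lF.
Qed.

Definition bilin U V W (F : U -> V -> W) : Prop :=
  (forall v, linear (F^~ v)) /\ (forall u, linear (F u)).

Lemma lin_tlift U U1 U2 V (F : U1 -> U2 -> V) (f : U -> tensor U1 U2) :
  bilin F -> linear f -> linear (fun x => tlift F (f x)).
Proof. by move=> [Fl Fr] lf a x y; rewrite lf (tlift_linear Fl Fr). Qed.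

Lemma linD U V (f : U -> V) : linear f -> forall x y, f (x + y) = f x + f y.
Proof. by move=> lf x y; rewrite -[x in LHS]scale1r lf scale1r. Qed.

Lemma linZ U V (f : U -> V) : linear f -> forall a x, f (a *: x) = a *: f x.
Proof. by move=> lf a x; rewrite -[in LHS](addr0 (a *: x)) lf (linE lf).1 addr0. Qed.

Lemma linB U V (f : U -> V) : linear f -> forall x y, f (x - y) = f x - f y.
Proof. by move=> lf x y; rewrite -!scaleN1r addrC lf addrC. Qed.

Lemma linS U V (f : U -> V) : linear f -> forall (J : Type) (s : seq J) (G : J -> U),
  f (\sum_(j <- s) G j) = \sum_(j <- s) f (G j).
Proof.
move=> lf J s G; elim: s => [|j s IHs]; first by rewrite !big_nil (linE lf).1.
by rewrite !big_cons linD // IHs.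
Qed.

Lemma tensP U V (t : tensor U V) : exists s : seq (U * V), t = \sum_(p <- s) p.1 *t p.2.
Proof.
elim/tensor_ind: t => [|a u v t [s ->]]; first by exists [::]; rewrite big_nil.
by exists ((a *: u, v) :: s); rewrite big_cons /= (linZ (@tensPl _ _ _ v)).
Qed.

Lemma tlift_tens U V W (F : U -> V -> W) u v : bilin F -> tlift F (u *t v) = F u v.
Proof. by case=> Fl Fr; exact: tliftE. Qed.

Lemma tlift_sum U V W (F : U -> V -> W) s : bilin F ->
  tlift F (\sum_(p <- s) p.1 *t p.2) = \sum_(p <- s) F p.1 p.2.
Proof.
move=> bF; have [Fl Fr] := bF; rewrite (linS (tlift_linear Fl Fr)).
by apply: eq_bigr => p _; rewrite tlift_tens.
Qed.

Lemma lin_tlift_fun U U1 U2 V (F : U -> U1 -> U2 -> V) t :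
  (forall x, bilin (F x)) -> (forall u v, linear (fun x => F x u v)) ->
  linear (fun x => tlift (F x) t).
Proof.
move=> bF lF; have [s ->] := tensP t => a x y; rewrite !tlift_sum //.
have L : linear (fun z => \sum_(p <- s) F z p.1 p.2) by apply: lin_sum => p; exact: lF.
exact: L.
Qed.

Lemma eq_tensor U V W (f g : tensor U V -> W) : linear f -> linear g ->
  (forall u v, f (u *t v) = g (u *t v)) -> forall t, f t = g t.
Proof.
move=> lf lg fg t; have [s ->] := tensP t; rewrite (linS lf) (linS lg).
by apply: eq_bigr => p _.
Qed.

End LinearFunctions.

Lemma linear_linear (k : fieldType) (U V : lmodType k) (g : {linear U -> V}) : linear g.
Proof. by move=> a x y; rewrite linearP. Qed.

(** Hook through which [lin] is later taught the actions on modules and bimodules. *)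
Ltac lin_more := fail.

Ltac lin := intros; cbv beta; first
  [ exact: lin_id | exact: linear_linear | assumption
  | apply: lin_sum; lin
  | apply: lin_mulr; lin | apply: lin_mull; lin
  | apply: lin_tensr; lin | apply: lin_tensl; lin
  | apply: lin_scaler; lin | apply: lin_scalel; lin
  | lin_more
  | apply: lin_app; lin
  | apply: lin_add; lin
  | idtac ].

Ltac bil := split => ?; lin.

Section TensorApprox.
Variables (k : fieldType) (U V : lmodType k).

Definition contract (f : V -> k^o) : tensor U V -> U := tlift (fun u v => (f v : k) *: u).

Lemma contract_linear (f : {linear V -> k^o}) : linear (contract f).
Proof. by apply: lin_tlift; [bil | lin]. Qed.

Lemma contractE (f : {linear V -> k^o}) u v : contract f (u *t v) = (f v : k) *: u.
Proof. by rewrite /contract tlift_tens //; bil. Qed.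

(** Take a finite-rank operator fixing every second factor of some expression of [t], and move its
    functionals to the first factors. *)
Lemma tensor_approx (t : tensor U V) : exists s : seq ({linear V -> k^o} * V),
  t = \sum_(p <- s) contract p.1 t *t p.2.
Proof.
have [l ->] := tensP t; have [s sE] := fin_rank_approx [seq p.2 | p <- l].
exists s; under [RHS]eq_bigr do rewrite (linS (contract_linear _)).
rewrite (eq_bigr (fun p : {linear V -> k^o} * V =>
    \sum_(q <- l) (contract p.1 (q.1 *t q.2)) *t p.2)); last first.
  by move=> p _; rewrite (linS (@tensPl _ _ _ p.2)).
rewrite exchange_big /=; apply: eq_big_seq => q free_coef.
rewrite -{1}(sE q.2); last by apply/mapP; exists q.
rewrite (linS (@tensPr _ _ _ q.1)); apply: eq_bigr => p _.
by rewrite contractE (linZ (@tensPl _ _ _ p.2)) (linZ (@tensPr _ _ _ q.1)).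
Qed.

End TensorApprox.

Lemma tassoc_linear (k : fieldType) (U V W : lmodType k) : linear (@tassoc k U V W).
Proof.
have b (w : W) : bilin (fun (u : U) (v : V) => u *t (v *t w)).
  by split=> ? a x y; rewrite ?tensPl ?tensPr.
apply: lin_tlift => //; split=> [w|t].
  exact: lin_tlift (b w) (@lin_id _ _).
apply: (@lin_tlift_fun _ _ _ _ _ (fun w u v => u *t (v *t w))) => // u v.
by lin.
Qed.

Section Sweedler.
Variables (k : fieldType) (H : bialgType k).

(** Sums over [sw h] replace Sweedler notation. The chosen sequence is not additive in [h]; bilinear
    sums over it are independent of the choice by [swlift]. *)
Definition sw (h : H) : seq (H * H) := sval (cid (tensP (comul h))).

Lemma swE h : comul h = \sum_(p <- sw h) p.1 *t p.2.
Proof. exact: (svalP (cid (tensP (comul h)))). Qed.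

Section Bilinear.
Variables (W : lmodType k) (F : H -> H -> W).
Hypothesis bF : bilin F.

Lemma swlift h : \sum_(p <- sw h) F p.1 p.2 = tlift F (comul h).
Proof. by rewrite swE tlift_sum. Qed.

Lemma lin_sw : linear (fun h => \sum_(p <- sw h) F p.1 p.2).
Proof.
move=> a x y; rewrite !swlift linearP.
by have [Fl Fr] := bF; rewrite (tlift_linear Fl Fr).
Qed.

Lemma sw1 : \sum_(p <- sw 1) F p.1 p.2 = F 1 1.
Proof.
rewrite swlift; have [-> _] := @comul_monoid_morphism k H.
by rewrite tlift_tens.
Qed.

Lemma swM g h : \sum_(p <- sw (g * h)) F p.1 p.2 =
  \sum_(p <- sw g) \sum_(q <- sw h) F (p.1 * q.1) (p.2 * q.2).
Proof.
have [Fl Fr] := bF; have lF := tlift_linear Fl Fr.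
rewrite swlift; have [_ ->] := @comul_monoid_morphism k H.
rewrite [comul g]swE [comul h]swE.
rewrite (_ : _ * _ = \sum_(p <- sw g) \sum_(q <- sw h) (p.1 * q.1) *t (p.2 * q.2)).
  rewrite (linS lF); apply: eq_bigr => p _; rewrite (linS lF); apply: eq_bigr => q _.
  by rewrite tlift_tens.
rewrite mulr_suml; apply: eq_bigr => p _; rewrite mulr_sumr; apply: eq_bigr => q _.
exact: tmulE.
Qed.

End Bilinear.

Lemma sw_counitl (W : lmodType k) (G : H -> W) h : linear G ->
  \sum_(p <- sw h) (counit p.1 : k) *: G p.2 = G h.
Proof.
move=> lG; rewrite -[in RHS](comul_counitl h) -swlift; last by bil.
by rewrite (linS lG); apply: eq_bigr => p _; rewrite linZ.
Qed.

Lemma sw_counitr (W : lmodType k) (G : H -> W) h : linear G ->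
  \sum_(p <- sw h) (counit p.2 : k) *: G p.1 = G h.
Proof.
move=> lG; rewrite -[in RHS](comul_counitr h) -swlift; last by bil.
by rewrite (linS lG); apply: eq_bigr => p _; rewrite linZ.
Qed.

Lemma sw_coassoc (W : lmodType k) (F : H -> H -> H -> W) h :
  (forall b c, linear (fun a => F a b c)) -> (forall a c, linear (fun b => F a b c)) ->
  (forall a b, linear (fun c => F a b c)) ->
  \sum_(p <- sw h) \sum_(q <- sw p.1) F q.1 q.2 p.2 =
  \sum_(p <- sw h) \sum_(q <- sw p.2) F p.1 q.1 q.2.
Proof.
move=> F1 F2 F3; pose G := tlift (fun a => tlift (F a)).
have bi a : bilin (F a) by split.
have bG : bilin (fun a => tlift (F a)).
  split=> [t|a]; first by apply: lin_tlift_fun.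
  by apply: lin_tlift.
have lG : linear G by apply: lin_tlift.
have := congr1 G (comulA h); rewrite [comul h]swE /tmap tlift_sum; last by bil.
rewrite tlift_sum; last by bil.
rewrite (linS (@tassoc_linear _ _ _ _)) !(linS lG) => e.
transitivity (\sum_(p <- sw h) G (tassoc (comul p.1 *t p.2))).
  apply: eq_bigr => p _; rewrite [comul p.1]swE (linS (@tensPl _ _ _ p.2)).
  rewrite (linS (@tassoc_linear _ _ _ _)) (linS lG); apply: eq_bigr => q _.
  by rewrite tassocE /G !tlift_tens.
rewrite e; apply: eq_bigr => p _; rewrite /= [comul p.2]swE (linS (@tensPr _ _ _ p.1)).
by rewrite (linS lG); apply: eq_bigr => q _; rewrite /G !tlift_tens.
Qed.

End Sweedler.

(** * The antipode and the opposite-coopposite Hopf algebra *)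

Section Antipode.
Variables (k : fieldType) (H : hopfAlgType k).
Local Notation S := (@antipode k H).

Lemma sw_antipodel (W : lmodType k) (G : H -> W) h : linear G ->
  \sum_(p <- sw h) G (S p.1 * p.2) = (counit h : k) *: G 1.
Proof.
move=> lG; rewrite -(linZ lG) -antipodel -swlift; last by bil.
by rewrite (linS lG).
Qed.

Lemma sw_antipoder (W : lmodType k) (G : H -> W) h : linear G ->
  \sum_(p <- sw h) G (p.1 * S p.2) = (counit h : k) *: G 1.
Proof.
move=> lG; rewrite -(linZ lG) -antipoder -swlift; last by bil.
by rewrite (linS lG).
Qed.

Lemma antipode1 : S 1 = 1.
Proof.
have := @sw_antipodel _ (fun x => x) 1 (@lin_id _ _).
by rewrite (sw1 (F := fun a b => S a * b)) ?mulr1 ?rmorph1 ?scale1r //; bil.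
Qed.

(* Both sides are convolution inverse to the multiplication H (x) H -> H. *)
Lemma antipodeM x y : S (x * y) = S y * S x.
Proof.
(* Summed over the coproduct of [x] this is S(x_1 y_1) x_2 y_2 S(y_3) S(x_3): contracting the last
   factors gives S(x y), contracting the first ones gives S(y) S(x). *)
pose G a b c := \sum_(q <- sw y) \sum_(r <- sw q.2) S (a * q.1) * (b * (r.1 * S r.2) * S c).
have lS : linear S by exact: linear_linear.
have -> : S (x * y) = \sum_(p <- sw x) \sum_(r <- sw p.2) G p.1 r.1 r.2.
  transitivity (\sum_(p <- sw x) \sum_(r <- sw p.2) S (p.1 * y) * (r.1 * S r.2)).
    transitivity (\sum_(p <- sw x) (counit p.2 : k) *: S (p.1 * y)).
      by rewrite (@sw_counitr _ _ _ (fun a => S (a * y))) //; lin.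
    apply: eq_bigr => p _; rewrite (@sw_antipoder _ (fun a => S (p.1 * y) * a)) ?mulr1 //.
    by lin.
  apply: eq_bigr => p _; apply: eq_bigr => r _; rewrite /G.
  transitivity (\sum_(q <- sw y) (counit q.2 : k) *: (S (p.1 * q.1) * (r.1 * S r.2))).
    by rewrite (@sw_counitr _ _ _ (fun a => S (p.1 * a) * (r.1 * S r.2))) //; lin.
  apply: eq_bigr => q _.
  rewrite (@sw_antipoder _ (fun a => S (p.1 * q.1) * (r.1 * a * S r.2))) ?mulr1 //.
  by lin.
rewrite -(sw_coassoc (F := G)) /G; try by lin.
have -> : S y * S x = \sum_(p <- sw x) (counit p.1 : k) *: (S y * S p.2).
  by rewrite (@sw_counitl _ _ _ (fun a => S y * S a)) //; lin.
apply: eq_bigr => p _.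
have -> : (counit p.1 : k) *: (S y * S p.2) =
    \sum_(q <- sw y) (counit p.1 : k) *: ((counit q.1 : k) *: (S q.2 * S p.2)).
  by rewrite -scaler_sumr (@sw_counitl _ _ _ (fun a => S a * S p.2)) //; lin.
transitivity (\sum_(r <- sw p.1) \sum_(q <- sw y) \sum_(s <- sw q.1)
   (S (r.1 * s.1) * (r.2 * s.2)) * (S q.2 * S p.2)).
  apply: eq_bigr => r _.
  rewrite -(sw_coassoc (F := fun a b c => S (r.1 * a) * (r.2 * (b * S c) * S p.2))); try by lin.
  by apply: eq_bigr => q _; apply: eq_bigr => s _; rewrite !mulrA.
rewrite exchange_big /=; apply: eq_bigr => q _.
rewrite -(swM (F := fun a b => S a * b * (S q.2 * S p.2))); last by bil.
rewrite (@sw_antipodel _ (fun a => a * (S q.2 * S p.2))); last by lin.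
rewrite mul1r scalerA; congr (_ *: _); exact: (rmorphM counit).
Qed.

Lemma counit_antipode h : counit (S h) = counit h.
Proof.
pose c := @counit k H.
have lc : linear c by exact: linear_linear.
have -> : c (S h) = \sum_(p <- sw h) c (S p.1 * p.2).
  transitivity (\sum_(p <- sw h) (c p.2 : k) *: (c (S p.1) : k^o)).
    by rewrite (@sw_counitr _ _ _ (fun a => c (S a) : k^o)) //; lin.
  by apply: eq_bigr => p _; rewrite /c (rmorphM counit) mulrC.
rewrite (@sw_antipodel k^o c) // /c (rmorph1 counit).
exact: mulr1.
Qed.

End Antipode.

Section OppositeHopf.
Variables (k : fieldType) (H : hopfAlgType k).

(** Product and coproduct are both reversed, so that the same S is again an antipode; reversing only
    one of them would call for its inverse. *)
Definition comul_op (h : H^c) : tensor H^c H^c :=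
  tlift (fun a b : H => (b : H^c) *t (a : H^c)) (comul (h : H)).

Fact comul_op_bilin : bilin (fun a b : H => (b : H^c) *t (a : H^c)).
Proof. by split=> c a x y; [exact: (@tensPr k H^c H^c) | exact: (@tensPl k H^c H^c)]. Qed.

Fact comul_op_linear : linear comul_op.
Proof.
move=> a x y; have [Fl Fr] := comul_op_bilin.
by rewrite /comul_op (@linearP k H _ _ comul a x y) (tlift_linear Fl Fr).
Qed.
Definition comul_op_lin : {linear H^c -> tensor H^c H^c} :=
  HB.pack comul_op (GRing.isLinear.Build k H^c (tensor H^c H^c) _ comul_op comul_op_linear).

Lemma comul_opE (h : H) : comul_op_lin h = \sum_(p <- sw h) (p.2 : H^c) *t (p.1 : H^c).
Proof. by rewrite /= /comul_op -(swlift comul_op_bilin). Qed.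

Fact comul_op_sw (W : lmodType k) (F : H^c -> H^c -> W) (h : H) : bilin F ->
  tlift F (comul_op_lin h) = \sum_(p <- sw h) F p.2 p.1.
Proof.
move=> bF; have [Fl Fr] := bF.
rewrite comul_opE (linS (tlift_linear Fl Fr)).
by apply: eq_bigr => p _; rewrite tlift_tens.
Qed.

Fact comul_opA (h : H^c) :
  tassoc (tmap comul_op_lin id (comul_op_lin h)) = tmap id comul_op_lin (comul_op_lin h).
Proof.
rewrite /tmap !comul_op_sw; try by bil.
transitivity (\sum_(p <- sw (h : H)) \sum_(q <- sw p.2)
   ((q.2 : H^c) *t ((q.1 : H^c) *t (p.1 : H^c)))).
  rewrite (linS (@tassoc_linear k H^c H^c H^c)); apply: eq_bigr => p _.
  rewrite comul_opE (linS (@tensPl k (tensor H^c H^c) H^c p.1)).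
  rewrite (linS (@tassoc_linear k H^c H^c H^c)); apply: eq_bigr => q _.
  exact: tassocE.
rewrite -(sw_coassoc (F := fun a b c : H => (c : H^c) *t ((b : H^c) *t (a : H^c)))).
- apply: eq_bigr => p _; rewrite comul_opE.
  by rewrite (linS (@tensPr k H^c (tensor H^c H^c) p.2)).
- by move=> b c a x y; rewrite !(@tensPr k).
- by move=> b c a x y; rewrite (@tensPl k H^c H^c) (@tensPr k).
- by move=> b c a x y; rewrite (@tensPl k H^c).
Qed.

Fact comul_op_counitl (h : H^c) :
  tlift (fun a b : H^c => (counit_op H a : k) *: b) (comul_op_lin h) = h.
Proof.
rewrite comul_op_sw; last by bil.
exact: (@sw_counitr k H H (fun a => a) h (@lin_id _ _)).
Qed.

Fact comul_op_counitr (h : H^c) :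
  tlift (fun a b : H^c => (counit_op H b : k) *: a) (comul_op_lin h) = h.
Proof.
rewrite comul_op_sw; last by bil.
exact: (@sw_counitl k H H (fun a => a) h (@lin_id _ _)).
Qed.

Fact comul_op_monoid : monoid_morphism comul_op_lin.
Proof.
split=> [|x y]; first by rewrite comul_opE (sw1 comul_op_bilin).
rewrite [comul_op_lin (x * y)]comul_opE.
rewrite (swM (F := fun a b : H => (b : H^c) *t (a : H^c)) comul_op_bilin).
rewrite exchange_big !comul_opE /= mulr_suml; apply: eq_bigr => p _.
rewrite mulr_sumr; apply: eq_bigr => q _; apply/esym.
exact: (@tmulE k H^c H^c).
Qed.

HB.instance Definition _ := Algebra_isBialgebra.Build k H^c
  comul_opA comul_op_counitl comul_op_counitr comul_op_monoid.

Definition antipode_op : H^c -> H^c := @antipode k H.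
Fact antipode_op_linear : linear antipode_op.
Proof. exact: (@linearP k H H _ antipode). Qed.
Definition antipode_op_lin : {linear H^c -> H^c} :=
  HB.pack antipode_op (GRing.isLinear.Build k H^c H^c _ antipode_op antipode_op_linear).

Fact antipode_opl (h : H^c) :
  tlift (fun a b : H^c => antipode_op_lin a * b) (comul h) = counit h *: 1.
Proof.
rewrite [comul h]/(comul_op_lin h) comul_op_sw; last by bil.
exact: (@sw_antipoder k H H (fun a => a) h (@lin_id _ _)).
Qed.

Fact antipode_opr (h : H^c) :
  tlift (fun a b : H^c => a * antipode_op_lin b) (comul h) = counit h *: 1.
Proof.
rewrite [comul h]/(comul_op_lin h) comul_op_sw; last by bil.
exact: (@sw_antipodel k H H (fun a => a) h (@lin_id _ _)).
Qed.

HB.instance Definition _ := Bialgebra_isHopf.Build k H^c antipode_opl antipode_opr.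


End OppositeHopf.

(** * Bimodules: adjoint modules and induction *)

Section ScalarRestriction.
Variables (k : fieldType) (A : algType k) (M : lmodType A).

Definition kmod : Type := M.
HB.instance Definition _ := GRing.Zmodule.copy kmod M.
Definition kact (a : A) (m : kmod) : kmod := a *: (m : M).
Definition kscale (c : k) (m : kmod) : kmod := kact (c%:A) m.
Fact kscaleA a b x : kscale a (kscale b x) = kscale (a * b) x.
Proof. by rewrite /kscale /kact scalerA mulr_algl scalerA. Qed.
Fact kscale1 : left_id 1 kscale.
Proof. by move=> x; rewrite /kscale /kact !scale1r. Qed.
Fact kscaleDr : right_distributive kscale +%R.
Proof. by move=> a x y; exact: scalerDr. Qed.
Fact kscaleDl x : {morph kscale^~ x : a b / a + b}.
Proof. by move=> a b; rewrite /kscale /kact !scalerDl. Qed.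
HB.instance Definition _ := GRing.Zmodule_isLmodule.Build k kmod
  kscaleA kscale1 kscaleDr kscaleDl.

Lemma kmod_scaleE (c : k) (x : kmod) : c *: x = c%:A *: (x : M).
Proof. by []. Qed.

Lemma kactl_linear m : linear (kact^~ m).
Proof.
by move=> c a b; rewrite kmod_scaleE /kact scalerDl scalerA mulr_algl.
Qed.

Lemma kactr_linear a : linear (kact a).
Proof.
move=> c x y; rewrite !kmod_scaleE /kact scalerDr !scalerA.
by rewrite mulr_algr mulr_algl.
Qed.

Lemma kact1 m : kact 1 m = m.
Proof. by rewrite /kact scale1r. Qed.

Lemma kactM a b m : kact (a * b) m = kact a (kact b m).
Proof. by rewrite /kact scalerA. Qed.

End ScalarRestriction.

Section Bimodules.
Variables (k : fieldType) (A : algType k).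

Record bimod := Bimod {
  bcar :> lmodType k;
  bl : A -> bcar -> bcar;
  br : A -> bcar -> bcar;
  bl_bilin : bilin bl;
  br_bilin : bilin br;
  bl1 : forall x, bl 1 x = x;
  blM : forall a b x, bl (a * b) x = bl a (bl b x);
  br1 : forall x, br 1 x = x;
  brM : forall a b x, br (a * b) x = br b (br a x);
  blr : forall a b x, bl a (br b x) = br b (bl a x) }.

Implicit Types X Y : bimod.

Lemma lin_bll (U : lmodType k) X (f : U -> A) (x : X) : linear f -> linear (fun u => bl (f u) x).
Proof. by move=> lf a u v; rewrite lf (@bl_bilin X).1. Qed.
Lemma lin_blr (U : lmodType k) X (f : U -> X) a : linear f -> linear (fun u => bl a (f u)).
Proof. by move=> lf b u v; rewrite lf (@bl_bilin X).2. Qed.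
Lemma lin_brl (U : lmodType k) X (f : U -> A) (x : X) : linear f -> linear (fun u => br (f u) x).
Proof. by move=> lf a u v; rewrite lf (@br_bilin X).1. Qed.
Lemma lin_brr (U : lmodType k) X (f : U -> X) a : linear f -> linear (fun u => br a (f u)).
Proof. by move=> lf b u v; rewrite lf (@br_bilin X).2. Qed.

Lemma lin_kactl (U : lmodType k) (M : lmodType A) (f : U -> A) (m : kmod M) :
  linear f -> linear (fun u => kact (f u) m).
Proof. by move=> lf b u v; rewrite lf kactl_linear. Qed.
Lemma lin_kactr (U : lmodType k) (M : lmodType A) (f : U -> kmod M) a :
  linear f -> linear (fun u => kact a (f u)).
Proof. by move=> lf b u v; rewrite lf kactr_linear. Qed.

Definition om_bimod X : opmod (A * A)%type.
Proof.
refine (@OpMod _ X (fun p x => bl p.1 (br p.2 x)) _).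
abstract by move=> p x y; rewrite -!scaleN1r addrC [RHS]addrC (@br_bilin X).2 (@bl_bilin X).2.
Defined.

Definition bimor X Y (f : X -> Y) : Prop :=
  [/\ linear f, forall a x, f (bl a x) = bl a (f x) & forall a x, f (br a x) = br a (f x)].

(** Linearity over [k] comes for free, because a scalar c acts as the left operator by c times 1. *)
Lemma bimorP X Y (f : X -> Y) : bimor f <-> @omor _ (om_bimod X) (om_bimod Y) f.
Proof.
split=> [[lf fl fr]|fm].
  split=> [x y|p x] /=; last by rewrite fl fr.
  by rewrite -!scaleN1r addrC lf addrC.
have [fB fa] := fm.
have fl a x : f (bl a x) = bl a (f x) by have := fa (a, 1) x; rewrite /= !br1.
have fr a x : f (br a x) = br a (f x) by have := fa (1, a) x; rewrite /= !bl1.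
split=> // c x y; rewrite (omorD fm); congr (_ + _).
rewrite -[x in LHS]bl1 -[f x]bl1 -(linZ ((@bl_bilin X).1 x)) fl.
by rewrite (linZ ((@bl_bilin Y).1 (f x))).
Qed.

End Bimodules.

Ltac lin_more ::= first
  [ apply: lin_blr; lin | apply: lin_bll; lin | apply: lin_brr; lin | apply: lin_brl; lin
  | apply: lin_kactr; lin | apply: lin_kactl; lin ].

Section OppositeBimodules.
Variables (k : fieldType) (A : algType k).

Definition bopp (X : bimod A) : bimod A^c.
Proof.
exact (@Bimod k A^c X (@br k A X) (@bl k A X) (@br_bilin k A X) (@bl_bilin k A X)
  (@br1 k A X) (fun a b => @brM k A X b a) (@bl1 k A X) (fun a b => @blM k A X b a)
  (fun a b x => esym (@blr k A X b a x))).
Defined.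

Definition bunopp (X : bimod A^c) : bimod A.
Proof.
exact (@Bimod k A X (@br k A^c X) (@bl k A^c X) (@br_bilin k A^c X) (@bl_bilin k A^c X)
  (@br1 k A^c X) (fun a b => @brM k A^c X b a) (@bl1 k A^c X) (fun a b => @blM k A^c X b a)
  (fun a b x => esym (@blr k A^c X b a x))).
Defined.

Lemma bopp_mor (X Y : bimod A) (f : X -> Y) : bimor f -> @bimor _ _ (bopp X) (bopp Y) f.
Proof. by case. Qed.

Lemma bunopp_mor (X Y : bimod A^c) (f : X -> Y) : bimor f -> @bimor _ _ (bunopp X) (bunopp Y) f.
Proof. by case. Qed.

End OppositeBimodules.

Section OperatorModulesOfModules.
Variable R : pzRingType.

Definition om_mod (M : lmodType R) : opmod R :=
  @OpMod R M (fun a x => a *: x) (@scalerBr R M).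

Lemma om_modP (M N : lmodType R) (f : M -> N) : linear f <-> @omor _ (om_mod M) (om_mod N) f.
Proof.
split=> [lf|fm].
  pose F : {linear M -> N} := HB.pack f (GRing.isLinear.Build R M N _ f lf).
  by split=> [x y|a x]; [exact: (linearB F) | exact: (linearZ_LR F)].
by have [fB fa] := fm => a x y; rewrite (omorD fm); congr (_ + _); exact: fa.
Qed.

End OperatorModulesOfModules.

Section AdjointModule.
Variables (k : fieldType) (H : hopfAlgType k) (X : bimod H).
Local Notation S := (@antipode k H).

(** The left adjoint module: Ext from the trivial module into it is the Hochschild cohomology of [H]
    with values in [X]. *)
Definition admod : Type := X.
HB.instance Definition _ := GRing.Zmodule.copy admod X.

Definition adact (h : H) (x : admod) : admod :=
  \sum_(p <- sw h) bl p.1 (br (S p.2) (x : X)).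

Fact adactA a b x : adact a (adact b x) = adact (a * b) x.
Proof.
rewrite /adact (swM (F := fun a b => bl a (br (S b) (x : X)))); last by bil.
apply: eq_bigr => p _.
have lb : linear (fun x : X => bl p.1 (br (S p.2) x)) by lin.
rewrite (linS lb); apply: eq_bigr => q _.
by rewrite antipodeM brM blM [bl q.1 (br (S p.2) _)]blr.
Qed.

Fact adact1 : left_id 1 adact.
Proof.
move=> x; rewrite /adact (sw1 (F := fun a b => bl a (br (S b) (x : X)))) ?antipode1 ?br1 ?bl1 //.
by bil.
Qed.

Fact adactr_linear h : linear (adact h : X -> X).
Proof. by rewrite /adact; lin. Qed.

Fact adactl_linear x : linear (adact^~ x : H -> X).
Proof. by apply: (lin_sw (F := fun a b => bl a (br (S b) (x : X)))); bil. Qed.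

Fact adactDr : right_distributive adact +%R.
Proof. by move=> h x y; exact: (linD (adactr_linear h) x y). Qed.
Fact adactDl x : {morph adact^~ x : a b / a + b}.
Proof. by move=> a b; exact: (linD (adactl_linear x) a b). Qed.
HB.instance Definition _ := GRing.Zmodule_isLmodule.Build H admod
  adactA adact1 adactDr adactDl.

Lemma adE (h : H) (x : admod) : h *: x = \sum_(p <- sw h) bl p.1 (br (S p.2) (x : X)).
Proof. by []. Qed.

Lemma ad_alg (c : k) (x : admod) : (c%:A : H) *: x = c *: (x : X).
Proof. by rewrite -[_ *: x]/(adact _ _) (linZ (adactl_linear x)) adact1. Qed.

End AdjointModule.

(* [ind M] is M (x) H with a (m (x) c) b = sum a_1 m (x) a_2 c b; the maps [ind_ext]
   and [ind_res] are the adjunction Hom_{H^e}(ind M, X) = Hom_H(M, admod X). *)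
Section Induction.
Variables (k : fieldType) (H : hopfAlgType k) (M : lmodType H).
Local Notation S := (@antipode k H).
Local Notation T := (tensor (kmod M) H).

Definition indl (a : H) (t : T) : T :=
  tlift (fun (m : kmod M) (c : H) => \sum_(p <- sw a) kact p.1 m *t (p.2 * c)) t.
Definition indr (b : H) (t : T) : T :=
  tlift (fun (m : kmod M) (c : H) => m *t (c * b)) t.

Fact indl_aux (a : H) :
  bilin (fun (m : kmod M) (c : H) => \sum_(p <- sw a) kact p.1 m *t (p.2 * c)).
Proof. by bil. Qed.
Fact indr_aux (b : H) : bilin (fun (m : kmod M) (c : H) => m *t (c * b)).
Proof. by bil. Qed.

Lemma indlE a (m : kmod M) c : indl a (m *t c) = \sum_(p <- sw a) kact p.1 m *t (p.2 * c).
Proof. exact: tlift_tens (indl_aux a). Qed.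
Lemma indrE b (m : kmod M) c : indr b (m *t c) = m *t (c * b).
Proof. exact: tlift_tens (indr_aux b). Qed.

Fact indl_bilin : bilin indl.
Proof.
split=> x; last by apply: lin_tlift; [exact: indl_aux | lin].
apply: lin_tlift_fun => [a|m c]; first exact: indl_aux.
by apply: (lin_sw (F := fun a b => kact a m *t (b * c))); bil.
Qed.

Fact indr_bilin : bilin indr.
Proof.
split=> x; last by apply: lin_tlift; [exact: indr_aux | lin].
by apply: lin_tlift_fun => [a|m c]; [exact: indr_aux | lin].
Qed.

Let lr b : linear (indr b). Proof. exact: indr_bilin.2. Qed.
Let ll a : linear (indl a). Proof. exact: indl_bilin.2. Qed.

Fact indl1 t : indl 1 t = t.
Proof.
apply: (eq_tensor (g := fun t => t)) => // m c; rewrite indlE.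
by rewrite (sw1 (F := fun a b => kact a m *t (b * c))) ?kact1 ?mul1r //; bil.
Qed.

Fact indlM a b t : indl (a * b) t = indl a (indl b t).
Proof.
apply: (eq_tensor (g := fun t => indl a (indl b t))) => // [|m c]; first exact: lin_comp.
rewrite !indlE (linS (ll a)) (swM (F := fun a b => kact a m *t (b * c))); last by bil.
rewrite exchange_big; apply: eq_bigr => q _; rewrite indlE.
by apply: eq_bigr => p _; rewrite kactM mulrA.
Qed.

Fact indr1 t : indr 1 t = t.
Proof. by apply: (eq_tensor (g := fun t => t)) => // m c; rewrite indrE mulr1. Qed.

Fact indrM a b t : indr (a * b) t = indr b (indr a t).
Proof.
apply: (eq_tensor (f := indr (a * b)) (g := fun t => indr b (indr a t))) => // [|m c].
  exact: lin_comp.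
by rewrite !indrE mulrA.
Qed.

Fact indlr a b t : indl a (indr b t) = indr b (indl a t).
Proof.
apply: (eq_tensor (f := fun t => indl a (indr b t)) (g := fun t => indr b (indl a t))) => [||m c].
- exact: lin_comp (ll a) (lr b).
- exact: lin_comp (lr b) (ll a).
rewrite indrE !indlE (linS (lr b)); apply: eq_bigr => p _.
by rewrite indrE mulrA.
Qed.

Definition ind : bimod H := Bimod indl_bilin indr_bilin indl1 indlM indr1 indrM indlr.

Section Adjunction.
Variable X : bimod H.

Definition ind_ext (f : M -> admod X) : ind -> X :=
  tlift (fun (m : kmod M) (c : H) => br c (f m : X)).

Definition ind_res (g : ind -> X) : M -> admod X := fun m => g ((m : kmod M) *t 1).

Section Extension.
Variable f : M -> admod X.
Hypothesis lf : linear f.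

Let lfk : linear (f : kmod M -> X).
Proof. by move=> c x y; rewrite kmod_scaleE lf ad_alg. Qed.

Let bf : bilin (fun (m : kmod M) (c : H) => br c (f m : X)).
Proof. by split=> c; [exact: lin_comp ((@br_bilin _ _ X).2 c) lfk | lin]. Qed.

Lemma ind_extE m c : ind_ext f ((m : kmod M) *t c) = br c (f m : X).
Proof. exact: tlift_tens. Qed.

(** Left linearity is the computation a_1 f(m) S(a_2) a_3 c = a f(m) c. *)
Lemma ind_ext_mor : bimor (ind_ext f).
Proof.
have le : linear (ind_ext f) by apply: lin_tlift; [exact: bf | lin].
split=> // a; apply: eq_tensor => [||m c].
- by apply: lin_comp => //; exact: ll.
- by apply: lin_comp => //; exact: (@bl_bilin _ _ X).2.
- rewrite /= indlE (linS le) ind_extE.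
  have fE h : f (kact h m) = h *: f m := ((om_modP f).1 lf).2 h m.
  pose G u v w : X := br c (br (S v * w) (bl u (f m : X))).
  transitivity (\sum_(p <- sw a) \sum_(q <- sw p.1) G q.1 q.2 p.2).
    apply: eq_bigr => p _; rewrite ind_extE fE adE brM.
    rewrite (linS ((@br_bilin _ _ X).2 p.2)) (linS ((@br_bilin _ _ X).2 c)).
    by apply: eq_bigr => q _; rewrite /G brM blr.
  rewrite (sw_coassoc (F := G)) /G; try by lin.
  transitivity (\sum_(p <- sw a) (counit p.2 : k) *: br c (bl p.1 (f m : X))).
    apply: eq_bigr => p _.
    rewrite (@sw_antipodel _ _ _ (fun v => br c (br v (bl p.1 (f m : X))))) ?br1 //.
    by lin.
  by rewrite (@sw_counitr _ _ _ (fun u => br c (bl u (f m : X)))) ?blr //; lin.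
- by apply: lin_comp => //; exact: lr.
- by apply: lin_comp => //; exact: (@br_bilin _ _ X).2.
- by rewrite /= indrE !ind_extE brM.
Qed.

End Extension.

(** Spread the unit as a_2 S(a_3): the value g(a_1 m (x) a_2 S(a_3)) has the left action of a_1 on m
    (x) 1 and the right action of S(a_2), after regrouping the coproduct. *)
Lemma ind_res_linear g : bimor g -> linear (ind_res g).
Proof.
case=> lg gl gr; apply/om_modP; split=> [x y|a m] /=.
  have B : linear (g \o (fun m : kmod M => m *t (1 : H))).
    by apply: lin_comp => //; lin.
  exact: (linB B x y).
rewrite adE /ind_res.
pose G u v w : ind := (kact u m : kmod M) *t (v * S w).
transitivity (\sum_(p <- sw a) \sum_(q <- sw p.2) g (G p.1 q.1 q.2)).
  transitivity (\sum_(p <- sw a) (counit p.2 : k) *: g (kact p.1 m *t (1 : H))).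
    rewrite (@sw_counitr _ _ _ (fun u => g (kact u m *t (1 : H)))) //.
    by apply: lin_comp => //; lin.
  apply: eq_bigr => p _.
  rewrite (@sw_antipoder _ _ _ (fun v => g (kact p.1 m *t v))) //; apply: lin_comp => //; lin.
rewrite -(sw_coassoc (F := fun u v w => g (G u v w))) /G;
  try by move=> *; apply: lin_comp => //; lin.
apply: eq_bigr => p _; rewrite -gr -gl -(linS lg); congr (g _).
by rewrite /= indrE indlE mul1r.
Qed.

Lemma ind_resK g : bimor g -> ind_ext (ind_res g) = g.
Proof.
move=> gm; have lf := ind_res_linear gm; have [lg gl gr] := gm.
apply/funext; apply: eq_tensor => // [|m c]; first by have [] := ind_ext_mor lf.
by rewrite ind_extE // /ind_res -gr /= indrE mul1r.
Qed.

End Adjunction.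
End Induction.

(** * Induced bimodule resolutions *)

Section ModuleComplexes.
Variable R : nzRingType.

Lemma projective_surj (P M N : lmodType R) (g : M -> N) (f : P -> N) :
  projective P -> linear g -> linear f -> is_surj g ->
  exists2 h : P -> M, linear h & forall p, g (h p) = f p.
Proof.
move=> Pp lg lf gs.
pose G : {linear M -> N} := HB.pack g (GRing.isLinear.Build R M N _ g lg).
pose F : {linear P -> N} := HB.pack f (GRing.isLinear.Build R P N _ f lf).
by have [h hE] := Pp _ _ G F gs; exists h => // a x y; rewrite linearP.
Qed.

Lemma projective_exact (P M N L : lmodType R) (g : M -> N) (d : N -> L) (f : P -> N) :
  projective P -> linear g -> linear d -> linear f ->
  (forall x, d x = 0 <-> exists y, g y = x) -> (forall p, d (f p) = 0) ->
  exists2 h : P -> M, linear h & forall p, g (h p) = f p.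
Proof.
move=> Pp lg ld lf ex df.
pose D : {linear N -> L} := HB.pack d (GRing.isLinear.Build R N L _ d ld).
have Dg m : ker_pred D D (g m) by apply/eqP/ex; exists m.
have Df p : ker_pred D D (f p) by apply/eqP.
have lg' : linear (fun m => Ker (Dg m)) by move=> a x y; apply: val_inj; exact: lg.
have lf' : linear (fun p => Ker (Df p)) by move=> a x y; apply: val_inj; exact: lf.
have [|h lh hE] := projective_surj Pp lg' lf'; last first.
  by exists h => // p; have := congr1 val (hE p).
move=> [x Dx]; have [y yx] := (ex x).1 (eqP Dx).
by exists y; apply: val_inj.
Qed.

Section Augmentation.
Variables (M : lmodType R) (P : resolution M).

Definition aug_obj (n : nat) : lmodType R := if n is m.+1 then P m else M.
Definition aug_d (n : nat) : {linear aug_obj n.+1 -> aug_obj n} :=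
  match n with 0 => res_aug P | m.+1 => res_d P m end.

Lemma aug_surj : is_surj (aug_d 0).
Proof. exact: res_aug_surj. Qed.

Lemma aug_exact n x : aug_d n x = 0 <-> exists y, aug_d n.+1 y = x.
Proof. by case: n x => [|n] x; [exact: res_exact0 | exact: res_exact]. Qed.

Lemma aug_d_linear n : linear (aug_d n).
Proof. by move=> a x y; rewrite linearP. Qed.

Definition mod_acyclic : acyclic R :=
  @Acyclic R (fun n => om_mod (aug_obj n)) aug_d
    (fun n => (om_modP (aug_d n)).1 (@aug_d_linear n)) aug_surj aug_exact.

End Augmentation.

Lemma mod_lifting (M N : lmodType R) (P : resolution M) (Q : resolution N) :
  (forall n, projective (P n)) -> lifting (mod_acyclic P) (mod_acyclic Q).
Proof.
move=> Pp n; split=> [f fm|m f fm f0].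
  have lf : linear (f : aug_obj P n.+1 -> aug_obj Q 0) by apply/om_modP.
  have [h lh hE] := projective_surj (Pp n) (@aug_d_linear _ Q 0) lf (@aug_surj _ Q).
  by exists h => //; apply/om_modP.
have lf : linear (f : aug_obj P n.+1 -> aug_obj Q m.+1) by apply/om_modP.
have [h lh hE] := projective_exact (Pp n) (@aug_d_linear _ Q m.+1) (@aug_d_linear _ Q m) lf
  (@aug_exact _ Q m) f0.
by exists h => //; apply/om_modP.
Qed.

End ModuleComplexes.

Section BimoduleComplexes.
Variables (k : fieldType) (A : algType k).

Record bicomplex := Bicomplex {
  bz :> nat -> bimod A;
  bd : forall n, bz n.+1 -> bz n;
  bd_mor : forall n, bimor (@bd n);
  bd_surj : is_surj (@bd 0);
  bd_exact : forall n x, @bd n x = 0 <-> exists y, @bd n.+1 y = x }.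

Definition bic_acyclic (B : bicomplex) : acyclic (A * A)%type :=
  @Acyclic _ (fun n => om_bimod (B n)) (@bd B) (fun n => (bimorP _).1 (@bd_mor B n))
    (@bd_surj B) (@bd_exact B).

End BimoduleComplexes.

Definition bic_unopp (k : fieldType) (A : algType k) (B : bicomplex A^c) : bicomplex A :=
  @Bicomplex k A (fun n => bunopp (B n)) (@bd _ _ B) (fun n => bunopp_mor (@bd_mor _ _ B n))
    (@bd_surj _ _ B) (@bd_exact _ _ B).

Section InducedComplexes.
Variables (k : fieldType) (H : hopfAlgType k).

Section InducedMap.
Variables (M N : lmodType H) (d : M -> N).
Hypothesis ld : linear d.

Definition ind_map : ind M -> ind N :=
  tlift (fun (m : kmod M) (c : H) => (d m : kmod N) *t c).

Lemma kmod_linear : linear (d : kmod M -> kmod N).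
Proof. by move=> c x y; rewrite kmod_scaleE ld. Qed.

Let bm : bilin (fun (m : kmod M) (c : H) => (d m : kmod N) *t c).
Proof. by split=> ?; [apply: lin_tensl; exact: kmod_linear | lin]. Qed.

Lemma ind_mapE (m : kmod M) (c : H) : ind_map (m *t c) = (d m : kmod N) *t c.
Proof. exact: tlift_tens. Qed.

Lemma ind_map_mor : bimor ind_map.
Proof.
have le : linear ind_map by apply: lin_tlift; [exact: bm | lin].
split=> // a; apply: eq_tensor => [||m c].
- by apply: lin_comp => //; exact: (@bl_bilin _ _ (ind M)).2.
- by apply: lin_comp => //; exact: (@bl_bilin _ _ (ind N)).2.
- rewrite /= indlE (linS le) ind_mapE indlE; apply: eq_bigr => p _.
  by rewrite ind_mapE; congr (_ *t _); exact: (((om_modP d).1 ld).2 p.1 m).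
- by apply: lin_comp => //; exact: (@br_bilin _ _ (ind M)).2.
- by apply: lin_comp => //; exact: (@br_bilin _ _ (ind N)).2.
- by rewrite /= indrE !ind_mapE indrE.
Qed.

Lemma contract_map (f : {linear H -> k^o}) t :
  contract f (ind_map t) = d (contract f t).
Proof.
have [le _ _] := ind_map_mor.
apply: (@eq_tensor _ _ _ _ (fun t => contract f (ind_map t))
         (fun t => d (contract f t) : kmod N)) => [||m c].
- exact: lin_comp (contract_linear f) le.
- exact: lin_comp kmod_linear (contract_linear f).
- by rewrite ind_mapE !contractE (linZ kmod_linear).
Qed.

End InducedMap.

Lemma ind_surj (M N : lmodType H) (d : M -> N) : linear d -> is_surj d -> is_surj (ind_map d).
Proof.
move=> ld ds; have [le _ _] := ind_map_mor ld.
have [s sE] := choice ds.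
move=> t; have [l ->] := tensP t.
exists (\sum_(p <- l) (s p.1 : kmod M) *t p.2).
by rewrite (linS le); apply: eq_bigr => p _; rewrite ind_mapE // sE.
Qed.

(** Tensoring over a field is exact: contraction by a functional commutes with the induced maps, so
    every contraction of a tensor killed by [e] lifts through [d], and finitely many contractions
    rebuild the tensor. *)
Lemma ind_exact (M N L : lmodType H) (d : M -> N) (e : N -> L) :
  linear d -> linear e -> (forall x, e x = 0 <-> exists y, d y = x) ->
  forall t, ind_map e t = 0 <-> exists y, ind_map d y = t.
Proof.
move=> ld le ex t.
have [ldm _ _] := ind_map_mor ld; have [lem _ _] := ind_map_mor le.
split=> [t0|[y <-]]; last first.
  have [l ->] := tensP y; rewrite (linS ldm) (linS lem) big1_seq // => p _.
  rewrite !ind_mapE //; have -> : e (d p.1) = 0 by apply/ex; exists p.1.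
  exact: (linE (@tensPl _ _ _ p.2)).1.
have [l lE] := tensor_approx t.
have lift (f : {linear H -> k^o}) : exists y, d y = contract f t.
  by apply/ex; rewrite -contract_map // t0 (linE (contract_linear f)).1.
have [s sE] := choice lift.
exists (\sum_(p <- l) (s p.1 : kmod M) *t p.2).
rewrite (linS ldm) [RHS]lE; apply: eq_bigr => p _.
by rewrite ind_mapE // sE.
Qed.

Section InducedResolution.
Variables (M : lmodType H) (P : resolution M).

Definition ind_bic : bicomplex H.
Proof.
refine (@Bicomplex k H (fun n => ind (aug_obj P n)) (fun n => ind_map (aug_d P n)) _ _ _).
- by move=> n; apply: ind_map_mor; exact: aug_d_linear.
- by apply: ind_surj; [exact: (@aug_d_linear _ _ P 0) | exact: aug_surj].
- move=> n x; apply: ind_exact; [exact: (@aug_d_linear _ _ P n.+1) | exact: aug_d_linear |].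
  exact: aug_exact.
Defined.

End InducedResolution.

Section LiftInduced.
Variable M : lmodType H.
Hypothesis Mp : projective M.

Lemma ad_map_linear (X Y : bimod H) (f : X -> Y) : bimor f -> linear (f : admod X -> admod Y).
Proof.
case=> lf fl fr; apply/om_modP; split=> [x y|a x] /=; first exact: (linB lf).
by rewrite !adE (linS lf); apply: eq_bigr => p _; rewrite fl fr.
Qed.

(** The adjunction turns a lifting problem for bimodule maps out of [ind M] into one for H-linear
    maps out of [M], where projectivity applies. *)
Lemma ind_lift_surj (X Y : bimod H) (f : X -> Y) (h : ind M -> Y) :
  bimor f -> bimor h -> is_surj f ->
  exists2 h' : ind M -> X, bimor h' & forall t, f (h' t) = h t.
Proof.
move=> fm hm fs; have lh := ind_res_linear hm.
have [g lg gE] := projective_surj Mp (ad_map_linear fm) lh fs.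
exists (ind_ext (X := X) g); first exact: ind_ext_mor.
move=> t; rewrite -(ind_resK hm); have [lf fl fr] := fm.
have [le _ _] := ind_ext_mor lg; have [le' _ _] := ind_ext_mor lh.
apply: (@eq_tensor _ _ _ _ (fun t => f (ind_ext (X := X) g t))) => // [|m c].
  exact: lin_comp.
by rewrite !ind_extE // fr gE.
Qed.

Lemma ind_lift_exact (X Y Z : bimod H) (f : X -> Y) (e : Y -> Z) (h : ind M -> Y) :
  bimor f -> bimor e -> bimor h -> (forall x, e x = 0 <-> exists y, f y = x) ->
  (forall t, e (h t) = 0) ->
  exists2 h' : ind M -> X, bimor h' & forall t, f (h' t) = h t.
Proof.
move=> fm em hm ex eh; have lh := ind_res_linear hm.
have [|g lg gE] := projective_exact Mp (ad_map_linear fm) (ad_map_linear em) lh ex.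
  by move=> p; exact: eh.
exists (ind_ext (X := X) g); first exact: ind_ext_mor.
move=> t; rewrite -(ind_resK hm); have [lf fl fr] := fm.
have [le _ _] := ind_ext_mor lg; have [le' _ _] := ind_ext_mor lh.
apply: (@eq_tensor _ _ _ _ (fun t => f (ind_ext (X := X) g t))) => // [|m c].
  exact: lin_comp.
by rewrite !ind_extE // fr gE.
Qed.

End LiftInduced.

Lemma ind_lifting (M : lmodType H) (P : resolution M) (B : bicomplex H) :
  (forall n, projective (P n)) -> lifting (bic_acyclic (ind_bic P)) (bic_acyclic B).
Proof.
move=> Pp n; split=> [f /bimorP fm|m f /bimorP fm f0].
  have [h hm hE] := ind_lift_surj (Pp n) (@bd_mor _ _ B 0) fm (@bd_surj _ _ B).
  by exists h => //; apply/bimorP.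
have [h hm hE] := ind_lift_exact (Pp n) (@bd_mor _ _ B m.+1) (@bd_mor _ _ B m) fm
  (@bd_exact _ _ B m) f0.
by exists h => //; apply/bimorP.
Qed.

End InducedComplexes.

Lemma ind_op_lifting (k : fieldType) (H : hopfAlgType k) (M : lmodType H^c)
    (P : resolution M) (B : bicomplex H) :
  (forall n, projective (P n)) ->
  lifting (bic_acyclic (bic_unopp (ind_bic (H := H^c) P))) (bic_acyclic B).
Proof.
move=> Pp n; split=> [f /bimorP fm|m f /bimorP fm f0].
  have [h hm hE] := ind_lift_surj (H := H^c) (Pp n) (bopp_mor (@bd_mor _ _ B 0)) (bopp_mor fm)
    (@bd_surj _ _ B).
  by exists h => //; apply/bimorP; exact: (bunopp_mor hm).
have [h hm hE] := ind_lift_exact (H := H^c) (Pp n) (bopp_mor (@bd_mor _ _ B m.+1))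
  (bopp_mor (@bd_mor _ _ B m)) (bopp_mor fm) (@bd_exact _ _ B m) f0.
by exists h => //; apply/bimorP; exact: (bunopp_mor hm).
Qed.

(** * Cocycles with values in adjoint modules, from the left and from the right *)

Section ModuleCocycles.
Variables (R : nzRingType) (M : lmodType R) (P : resolution M) (n : nat).

Definition mcyc (Y : lmodType R) (f : P n -> Y) : Prop :=
  @cocyc R (mod_acyclic P) n (om_mod Y) f.
Definition mbd (Y : lmodType R) (f : P n -> Y) : Prop :=
  @cobd R (mod_acyclic P) n (om_mod Y) f.

Lemma mcyc_linear (Y : lmodType R) (f : P n -> Y) : mcyc f -> linear f.
Proof. by case=> fm _; apply/om_modP. Qed.

End ModuleCocycles.

Section AdjointCocycles.
Variables (k : fieldType) (H : hopfAlgType k) (M : lmodType H) (P : resolution M).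
Variables (n : nat) (X : bimod H).
Implicit Types (f : P n -> admod X) (g : ind (P n) -> X).

Definition bcyc g : Prop := @cocyc _ (bic_acyclic (ind_bic P)) n (om_bimod X) g.
Definition bbd g : Prop := @cobd _ (bic_acyclic (ind_bic P)) n (om_bimod X) g.

Lemma ind_ext_map (N N' : lmodType H) (d : N -> N') (h : N' -> admod X) : linear d -> linear h ->
  forall t, ind_ext (X := X) h (ind_map d t) = ind_ext (X := X) (fun m => h (d m)) t.
Proof.
move=> ld lh; have lhd : linear (fun m => h (d m)) by move=> a x y; rewrite ld lh.
have [le _ _] := ind_ext_mor lh; have [le' _ _] := ind_ext_mor lhd.
have [lm _ _] := ind_map_mor ld.
apply: eq_tensor => [||m c] //; first exact: lin_comp.
by rewrite ind_mapE // !ind_extE.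
Qed.

Lemma ind_ext0 (N : lmodType H) t : ind_ext (X := X) (fun _ : N => 0) t = 0.
Proof.
have l0 : linear (fun _ : N => 0 : admod X) by move=> a x y; rewrite scaler0 addr0.
have [le _ _] := ind_ext_mor l0.
apply: (@eq_tensor _ _ _ _ _ (fun _ => 0)) => [||m c] //.
  by move=> a x y; rewrite scaler0 addr0.
by rewrite ind_extE //; exact: (linE ((@br_bilin _ _ X).2 c)).1.
Qed.

Lemma mcyc_bcyc f : mcyc f -> bcyc (ind_ext (X := X) f).
Proof.
move=> fc; have lf := mcyc_linear fc; case: fc => _ f0; split.
  by apply/bimorP; exact: ind_ext_mor.
move=> t; rewrite -(ind_ext0 (N := P n.+1) t).
apply: etrans (ind_ext_map (@aug_d_linear _ _ P n.+1) lf t) _.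
by congr (ind_ext (X := X) _ t); apply/funext => m; exact: f0.
Qed.

Lemma bcyc_mcyc g : bcyc g -> mcyc (ind_res g).
Proof.
case=> /bimorP gm g0; split; first by apply/om_modP; exact: ind_res_linear.
move=> m; rewrite /ind_res -(g0 ((m : kmod (P n.+1)) *t (1 : H))); congr g.
by apply/esym/ind_mapE; exact: (@aug_d_linear _ _ P n.+1).
Qed.

End AdjointCocycles.

Section AdjointCoboundaries.
Variables (k : fieldType) (H : hopfAlgType k) (M : lmodType H) (P : resolution M).
Variables (n : nat) (X : bimod H).
Implicit Types (f : P n -> admod X) (g : ind (P n) -> X).

Lemma mbd_bbd f : mbd f -> bbd (P := P) (ind_ext (X := X) f).
Proof.
rewrite /mbd /bbd; case: n f => [|m] f.
  by move=> f0 t; rewrite -(ind_ext0 X (N := P 0) t); congr (ind_ext (X := X) _ t); apply/funext.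
case=> h hm fE; have lh : linear (h : P m -> admod X) by apply/om_modP.
exists (ind_ext (X := X) (h : P m -> admod X)).
  by apply/bimorP; exact: ind_ext_mor.
move=> t; apply/esym; apply: etrans (ind_ext_map (@aug_d_linear _ _ P m.+1) lh t) _.
by congr (ind_ext (X := X) _ t); apply/funext => x; rewrite [RHS]fE.
Qed.

Lemma bbd_mbd g : bbd g -> mbd (P := P) (ind_res g).
Proof.
rewrite /mbd /bbd; case: n g => [|m] g; first by move=> g0 x; exact: g0.
case=> h /bimorP hm gE.
exists (ind_res (X := X) (M := P m) h).
  by apply/om_modP; exact: (ind_res_linear hm).
move=> x; rewrite /ind_res gE; congr h.
exact: (ind_mapE (@aug_d_linear _ _ P m.+1)).
Qed.

End AdjointCoboundaries.

Section OppositeCocycles.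
Variables (k : fieldType) (H : hopfAlgType k) (B : bicomplex H^c) (n : nat) (X : bimod H).
Implicit Type f : B n.+1 -> X.

Lemma cocyc_op f : @cocyc _ (bic_acyclic (bic_unopp B)) n (om_bimod X) f <->
  @cocyc _ (bic_acyclic B) n (om_bimod (bopp X)) f.
Proof.
split=> [[/bimorP fm f0]|[/bimorP fm f0]]; split=> //; apply/bimorP.
  exact: (bopp_mor fm).
exact: (bunopp_mor fm).
Qed.

End OppositeCocycles.

Lemma cobd_op (k : fieldType) (H : hopfAlgType k) (B : bicomplex H^c) (n : nat) (X : bimod H)
    (f : B n.+1 -> X) : @cobd _ (bic_acyclic (bic_unopp B)) n (om_bimod X) f <->
  @cobd _ (bic_acyclic B) n (om_bimod (bopp X)) f.
Proof.
case: n f => [|n] f //; split=> [[g /bimorP gm fE]|[g /bimorP gm fE]]; exists g => //; apply/bimorP.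
  exact: (bopp_mor gm).
exact: (bunopp_mor gm).
Qed.

(** * The regular bimodule as an induced module *)

Section TrivialInduced.
Variables (k : fieldType) (H : hopfAlgType k).

Lemma triv_kscale (c : k) (x : kmod (ltriv H)) : c *: x = c * (x : k) :> k.
Proof.
rewrite kmod_scaleE -[LHS]/(counit (c%:A : H) * (x : k)).
by rewrite (linearZ_LR counit) rmorph1; congr (_ * _); exact: mulr1.
Qed.

Lemma triv_kact (h : H) (x : kmod (ltriv H)) : kact h x = (counit h : k) *: x.
Proof. by apply: (etrans _ (esym (triv_kscale _ _))). Qed.

(** The counit absorbs a_1. With [ind_trivr], the module induced from the trivial one is H with its
    regular bimodule structure. *)
Lemma ind_trivl (a : H) (x : kmod (ltriv H)) (c : H) :
  @bl _ _ (ind (ltriv H)) a (x *t c) = x *t (a * c).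
Proof.
rewrite /= indlE -[RHS](@sw_counitl _ _ _ (fun u => x *t (u * c))); last by lin.
by apply: eq_bigr => p _; rewrite triv_kact (linZ (@tensPl _ _ _ _)).
Qed.

Lemma ind_trivr (a : H) (x : kmod (ltriv H)) (c : H) :
  @br _ _ (ind (ltriv H)) a (x *t c) = x *t (c * a).
Proof. exact: indrE. Qed.

Lemma triv_id_linear : linear ((fun x => x) : kmod (ltriv H) -> kmod (ltriv H^c)).
Proof.
by move=> c x y; congr (_ + _); exact: triv_kscale.
Qed.

End TrivialInduced.

(** * Comparison of the complexes induced from the two sides *)

Section Comparison.
Variables (k : fieldType) (H : hopfAlgType k).
Local Notation triv := (ltriv H).
Local Notation triv' := (ltriv H^c).

(** The identity of H, once both modules are identified with the regular bimodule; it is the index 0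
    map over which the two complexes are compared. *)
Definition triv_to_op : ind triv -> bunopp (ind triv') :=
  tlift (fun (x : kmod triv) (c : H) => (x : kmod triv') *t (c : H^c)).
Definition triv_of_op : bunopp (ind triv') -> ind triv :=
  tlift (fun (x : kmod triv') (c : H^c) => (x : kmod triv) *t (c : H)).

Lemma triv_inv_linear : linear ((fun x => x) : kmod triv' -> kmod triv).
Proof.
move=> c x y; apply/esym; exact: (@triv_id_linear k H c x y).
Qed.

Let b1 : bilin (fun (x : kmod triv) (c : H) => (x : kmod triv') *t (c : H^c)).
Proof.
split=> [c|x]; first exact: lin_tensl (@triv_id_linear k H).
exact: (@tensPr k (kmod triv') H^c x).
Qed.
Let b2 : bilin (fun (x : kmod triv') (c : H^c) => (x : kmod triv) *t (c : H)).
Proof.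
split=> [c|x]; first exact: lin_tensl triv_inv_linear.
exact: (@tensPr k (kmod triv) H x).
Qed.

Let l1 : linear triv_to_op. Proof. exact: lin_tlift b1 (@lin_id _ _). Qed.
Let l2 : linear triv_of_op. Proof. exact: lin_tlift b2 (@lin_id _ _). Qed.

Let E1 (x : kmod triv) (c : H) : triv_to_op (x *t c) = (x : kmod triv') *t (c : H^c).
Proof. exact: tlift_tens. Qed.
Let E2 (x : kmod triv') (c : H^c) : triv_of_op (x *t c) = (x : kmod triv) *t (c : H).
Proof. exact: tlift_tens. Qed.

Lemma triv_to_op_mor : bimor triv_to_op.
Proof.
split=> [|a|a]; [exact: l1 | apply: eq_tensor => [||x c] | apply: eq_tensor => [||x c]].
- exact: lin_comp l1 ((@bl_bilin _ _ (ind triv)).2 a).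
- exact: lin_comp ((@br_bilin _ _ (ind triv')).2 a) l1.
- by rewrite ind_trivl !E1; exact/esym/(@ind_trivr k H^c a x c).
- exact: lin_comp l1 ((@br_bilin _ _ (ind triv)).2 a).
- exact: lin_comp ((@bl_bilin _ _ (ind triv')).2 a) l1.
- by rewrite ind_trivr !E1; exact/esym/(@ind_trivl k H^c a x c).
Qed.

Lemma triv_to_opK : cancel triv_to_op triv_of_op.
Proof.
by apply: (@eq_tensor _ _ _ _ _ (fun t => t)) => [||x c] //; [exact: lin_comp | rewrite E1 E2].
Qed.

Lemma triv_of_opK : cancel triv_of_op triv_to_op.
Proof.
by apply: (@eq_tensor _ _ _ _ _ (fun t => t)) => [||x c] //; [exact: lin_comp | rewrite E2 E1].
Qed.

Lemma bimor_inv (A : algType k) (X Y : bimod A) (f : X -> Y) (g : Y -> X) :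
  cancel f g -> cancel g f -> bimor f -> bimor g.
Proof.
move=> fK gK [lf fl fr]; split=> [c x y|a x|a x].
- by rewrite -[x in LHS]gK -[y in LHS]gK -lf fK.
- by rewrite -[x in LHS]gK -fl fK.
- by rewrite -[x in LHS]gK -fr fK.
Qed.

Variables (P : resolution triv) (P' : resolution triv').
Hypothesis Pp : forall n, projective (P n).
Hypothesis Pp' : forall n, projective (P' n).
Variable n : nat.

Lemma ind_ext_comp (K : hopfAlgType k) (M : lmodType K) (X Y : bimod K) (t : X -> Y)
    (f : M -> admod X) : bimor t -> linear f -> forall z,
  ind_ext (X := Y) (fun y => t (f y)) z = t (ind_ext (X := X) f z).
Proof.
move=> tm lf; have ltf : linear (fun y => t (f y) : admod Y).
  by move=> a x y; rewrite lf; exact: (ad_map_linear tm).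
have [lt _ tr] := tm; have [le _ _] := ind_ext_mor ltf; have [le' _ _] := ind_ext_mor lf.
apply: (@eq_tensor _ _ _ _ _ (fun z => t (ind_ext (X := X) f z))) => [||m c] //.
  exact: lin_comp.
by rewrite !ind_extE // tr.
Qed.

Lemma ind_ext_sub (K : hopfAlgType k) (M : lmodType K) (X : bimod K)
    (f g : M -> admod X) : linear f -> linear g -> forall z,
  ind_ext (X := X) (fun y => f y - g y) z = ind_ext (X := X) f z - ind_ext (X := X) g z.
Proof.
move=> lf lg; have lfg : linear (fun y => f y - g y : admod X).
  by move=> a x y; rewrite lf lg scalerBr !opprD addrACA.
have [le _ _] := ind_ext_mor lfg; have [le1 _ _] := ind_ext_mor lf.
have [le2 _ _] := ind_ext_mor lg.
apply: (@eq_tensor _ _ _ _ _ (fun z => ind_ext (X := X) f z - ind_ext (X := X) g z)) => [||m c] //.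
  by move=> a x y; rewrite le1 le2 scalerBr !opprD addrACA.
by rewrite !ind_extE // (linB ((@br_bilin _ _ X).2 c)).
Qed.

(** A cocycle changes side by extension to a bimodule map, composition with a chain map, and
    restriction to the elements m (x) 1. Naturality in the coefficients is an equality of functions,
    not merely one modulo coboundaries, since the chain maps do not involve the coefficients. *)
Theorem ad_compare : exists
  (Phi : forall X : bimod H, (P n -> admod X) -> (P' n -> admod (bopp X)))
  (Psi : forall X : bimod H, (P' n -> admod (bopp X)) -> (P n -> admod X)),
  [/\ forall X f, (mcyc f -> mcyc (Phi X f)) /\ (mbd f -> mbd (Phi X f)),
      forall X f, (mcyc f -> mcyc (Psi X f)) /\ (mbd f -> mbd (Psi X f)),
      forall X f, mcyc f -> mbd (fun x => Psi X (Phi X f) x - f x),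
      forall X f, mcyc f -> mbd (fun x => Phi X (Psi X f) x - f x) &
      (forall X f g, mcyc f -> mcyc g -> mbd (fun x => f x - g x) ->
        mbd (fun x => Phi X f x - Phi X g x)) /\
      (forall X f g, mcyc f -> mcyc g -> mbd (fun x => f x - g x) ->
        mbd (fun x => Psi X f x - Psi X g x)) /\
      (forall (X Y : bimod H) (t : X -> Y) (f : P n -> admod X), bimor t -> mcyc f ->
        forall x, Phi Y (fun y => t (f y)) x = t (Phi X f x)) /\
      (forall (X Y : bimod H) (t : X -> Y) (f : P' n -> admod (bopp X)), bimor t -> mcyc f ->
        forall x, Psi Y (fun y => t (f y)) x = t (Psi X f x))].
Proof.
pose A := bic_acyclic (ind_bic P); pose B := bic_acyclic (bic_unopp (ind_bic (H := H^c) P')).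
have [u [v [[um vm] uc vc vu uv]]] := @comparison _ A B triv_to_op triv_of_op
  ((bimorP _).1 triv_to_op_mor)
  ((bimorP _).1 (bimor_inv triv_to_opK triv_of_opK triv_to_op_mor))
  triv_to_opK triv_of_opK (ind_lifting _ Pp) (ind_lifting _ Pp)
  (ind_op_lifting _ Pp') (ind_op_lifting _ Pp') n.
pose Phi (X : bimod H) (f : P n -> admod X) : P' n -> admod (bopp X) :=
  ind_res (H := H^c) (X := bopp X) (fun t => ind_ext (X := X) f (v t)).
pose Psi (X : bimod H) (f : P' n -> admod (bopp X)) : P n -> admod X :=
  ind_res (X := X) (fun t => ind_ext (H := H^c) (X := bopp X) f (u t)).
have Phic X f : mcyc f ->
    bcyc (H := H^c) (P := P') (X := bopp X) (fun t => ind_ext (X := X) f (v t)).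
  by move=> /mcyc_bcyc fc; apply/cocyc_op; exact: (vc _ _).1.
have Psic X f : mcyc f ->
    bcyc (P := P) (X := X) (fun t => ind_ext (H := H^c) (X := bopp X) f (u t)).
  move=> /mcyc_bcyc fc; apply: (uc _ _).1; exact/cocyc_op.
have Phib X f : mbd f -> mbd (Phi X f).
  by move/mbd_bbd=> fb; apply: bbd_mbd; apply/cobd_op; exact: (vc _ _).2.
have Psib X f : mbd f -> mbd (Psi X f).
  by move/mbd_bbd=> fb; apply: bbd_mbd; apply: (uc _ _).2; apply/cobd_op.
exists Phi, Psi; split.
- by move=> X f; split=> [fc|]; [exact/bcyc_mcyc/Phic | exact: Phib].
- by move=> X f; split=> [fc|]; [exact/bcyc_mcyc/Psic | exact: Psib].
- move=> X f fc; have lf := mcyc_linear fc; rewrite /Psi /Phi.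
  rewrite ind_resK; last by have [/bimorP] := Phic X f fc.
  have := bbd_mbd (vu _ _ (mcyc_bcyc fc)); congr (mbd _); apply/funext => x.
  by rewrite /ind_res ind_extE // br1.
- move=> X f fc; have lf := mcyc_linear fc; rewrite /Psi /Phi.
  rewrite ind_resK; last by have [/bimorP] := Psic X f fc.
  have /cocyc_op fc' := mcyc_bcyc fc; have /cobd_op /bbd_mbd := uv _ _ fc'.
  congr (mbd _); apply/funext => x.
  by rewrite /ind_res ind_extE // br1.
- split=> [X f g /mcyc_linear lf /mcyc_linear lg /Phib|].
    by congr (mbd _); apply/funext => x; rewrite /Phi /ind_res ind_ext_sub.
  split=> [X f g /mcyc_linear lf /mcyc_linear lg /Psib|].
    by congr (mbd _); apply/funext => x; rewrite /Psi /ind_res (@ind_ext_sub H^c).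
  split=> X Y t f tm fc x; have lf := mcyc_linear fc; rewrite /Phi /Psi /ind_res.
    by rewrite ind_ext_comp.
  exact: (@ind_ext_comp H^c _ (bopp X) (bopp Y) t f (bopp_mor tm) lf).
Qed.

End Comparison.

(** * Finiteness of cocycles and one-dimensional Ext *)

Section Finitary.
Variable R : nzRingType.

(* The form in which a resolution by finitely generated projectives is used: a
   cocycle class with values in [Y] is fixed by some operator of any family [T]
   that approximates the identity of [Y] on finite sets. Unlike the existence of
   the resolution itself, this passes at once from left to right modules. *)
Definition finitary (M : lmodType R) (P : resolution M) (n : nat) : Prop :=
  forall (Y : lmodType R) (T : (Y -> Y) -> Prop),
    (forall t, T t -> linear t) ->
    (forall s : seq Y, exists2 t, T t & {in s, forall y, t y = y}) ->
  forall g : P n -> Y, mcyc g -> exists2 t, T t & mbd (fun x => t (g x) - g x).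

Lemma mbd_sub (M : lmodType R) (P : resolution M) n (Y : lmodType R) (f g : P n -> Y) :
  mbd f -> mbd g -> mbd (fun x => f x - g x).
Proof. exact: cobd_sub. Qed.

Lemma mbd_add (M : lmodType R) (P : resolution M) n (Y : lmodType R) (f g : P n -> Y) :
  mbd f -> mbd g -> mbd (fun x => f x + g x).
Proof. exact: cobd_add. Qed.

Lemma mbd_comp (M : lmodType R) (P : resolution M) n (Y Z : lmodType R) (t : Y -> Z)
    (f : P n -> Y) : linear t -> mbd f -> mbd (fun x => t (f x)).
Proof. by move=> /om_modP lt; exact: cobd_comp lt. Qed.

Lemma mcyc_comp (M : lmodType R) (P : resolution M) n (Y Z : lmodType R) (t : Y -> Z)
    (f : P n -> Y) : linear t -> mcyc f -> mcyc (fun x => t (f x)).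
Proof. by move=> /om_modP lt; exact: cocyc_comp lt. Qed.

(** Modulo coboundaries g is g v u, and g v is determined by its values at the finitely many
    generators of [Q n]; an operator fixing these values fixes g v, hence the class of g. *)
Lemma finitary_fg (M : lmodType R) (P Q : resolution M) n :
  (forall n, projective (P n)) -> (forall n, projective (Q n) /\ finitely_generated (Q n)) ->
  finitary P n.
Proof.
move=> Pp Qp Y T Tl Ta g gc.
have {}Qf := (Qp n).2; have {}Qp i := (Qp i).1.
have id_om : omor (fun x : om_mod M => x) by [].
have [//|//|u [v [[um vm] _ _ vu _]]] := @comparison _ (mod_acyclic P) (mod_acyclic Q)
  (fun x => x) (fun x => x) id_om id_om _ _
  (mod_lifting _ Pp) (mod_lifting _ Pp) (mod_lifting _ Qp) (mod_lifting _ Qp) n.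
have [m [x xg]] := Qf.
have [t Tt tE] := Ta [seq g (v (x i)) | i <- enum 'I_m].
have lt := Tl _ Tt; exists t => //.
have lgv : linear (fun q : Q n => g (v q)).
  by have /om_modP l := omor_comp gc.1 vm.
have fix_gv (q : Q n) : t (g (v q)) = g (v q).
  pose G : {linear Q n -> Y} :=
    HB.pack (fun q : Q n => g (v q)) (GRing.isLinear.Build _ _ _ _ _ lgv).
  pose F : {linear Y -> Y} := HB.pack t (GRing.isLinear.Build _ _ _ _ _ lt).
  have [c ->] := xg q; rewrite -[LHS]/(F (G _)) -[RHS]/(G _) !linear_sum.
  apply: eq_bigr => i _; rewrite !linearZ /=; congr (_ *: _); apply: tE.
  by apply/mapP; exists i => //; rewrite mem_enum.
have gb := vu _ _ gc; have := mbd_sub gb (mbd_comp lt gb).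
congr (mbd _); apply/funext => y.
have tB a b : t (a - b) = t a - t b by have [] := (om_modP t).1 lt.
by rewrite tB fix_gv opprB addrC addrA subrK.
Qed.

End Finitary.

(* On [trivR M] the adjoint module is [M] itself, so the comparison of left and
   right cocycles applies to arbitrary one-sided modules. *)
Section TrivialRight.
Variables (k : fieldType) (H : hopfAlgType k).

Section Bimodule.
Variable M : lmodType H.

Definition trr (b : H) (x : kmod M) : kmod M := (counit b : k) *: x.
Fact trl_bilin : bilin (@kact k H M). Proof. by bil. Qed.
Fact trr_bilin : bilin trr. Proof. by rewrite /trr; bil. Qed.
Fact trr1 x : trr 1 x = x. Proof. by rewrite /trr rmorph1 scale1r. Qed.
Fact trrM a b x : trr (a * b) x = trr b (trr a x).
Proof. by rewrite /trr (rmorphM counit) scalerA mulrC. Qed.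
Fact trlr a b x : kact a (trr b x) = trr b (kact a x).
Proof. by rewrite /trr (linZ (kactr_linear _)). Qed.

Definition trivR : bimod H :=
  Bimod trl_bilin trr_bilin (@kact1 k H M) (@kactM k H M) trr1 trrM trlr.

Lemma trivR_ad (h : H) (x : M) : h *: (x : admod trivR) = h *: x.
Proof.
rewrite adE /= -[RHS]/(kact h x) -[RHS](@sw_counitr _ _ _ (fun u => kact u x)); last by lin.
apply: eq_bigr => p _; rewrite /trr counit_antipode (linZ (kactr_linear _)) //.
Qed.

Lemma trivR_mor (t : M -> M) : linear t -> @bimor _ _ trivR trivR t.
Proof.
move=> lt; have lk := kmod_linear lt; split=> // a x /=.
  exact: (((om_modP t).1 lt).2 a x).
by rewrite /trr (linZ lk).
Qed.

End Bimodule.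

Lemma to_trivR_linear (M : lmodType H) : linear ((fun x => x) : M -> admod (trivR M)).
Proof. by move=> a x y; rewrite trivR_ad. Qed.
Lemma of_trivR_linear (M : lmodType H) : linear ((fun x => x) : admod (trivR M) -> M).
Proof. by move=> a x y; rewrite trivR_ad. Qed.

End TrivialRight.

(** * Invariance of the finiteness property under change of side *)

Section FinitaryTransfer.
Variables (k : fieldType) (H : hopfAlgType k).
Variables (P : resolution (ltriv H)) (P' : resolution (ltriv H^c)).
Hypothesis Pp : forall n, projective (P n).
Hypothesis Pp' : forall n, projective (P' n).
Variable n : nat.

Lemma mbd_trans (R : nzRingType) (M : lmodType R) (Q : resolution M) (Y : lmodType R)
    (f g h : Q n -> Y) :
  mbd (fun x => f x - g x) -> mbd (fun x => g x - h x) -> mbd (fun x => f x - h x).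
Proof.
move=> fg gh; have := mbd_add fg gh; congr (mbd _); apply/funext => x.
by rewrite addrA subrK.
Qed.

Lemma mbd_sym (R : nzRingType) (M : lmodType R) (Q : resolution M) (Y : lmodType R)
    (f g : Q n -> Y) : mbd (fun x => f x - g x) -> mbd (fun x => g x - f x).
Proof.
move=> fg; have := @cobd_opp _ _ _ _ _ fg; congr (cobd _); apply/funext => x.
by rewrite opprB.
Qed.

(** Linear operators on [Y] are bimodule endomorphisms once the other side acts through the counit,
    so by naturality an operator fixing the class of [Psi X g] also fixes that of [g]. *)
Lemma finitary_op : finitary P n -> finitary P' n.
Proof.
have [Phi [Psi [Phic Psic PsiPhi PhiPsi [Phie [Psie [Phin Psin]]]]]] := ad_compare Pp Pp' n.
move=> fP Y T Tl Ta g gc; pose X := bunopp (@trivR k H^c Y).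
have gc' : mcyc (g : P' n -> admod (bopp X)) := mcyc_comp (@to_trivR_linear k H^c Y) gc.
have [|t Tt tb] := fP (admod X) T _ Ta (Psi X g) ((Psic X g).1 gc').
  move=> t /Tl lt; apply: (@ad_map_linear _ _ X X); apply: bunopp_mor.
  exact: (@trivR_mor k H^c Y).
have lt := Tl t Tt; have tm : @bimor _ _ X X t.
  by apply: bunopp_mor; exact: (@trivR_mor k H^c Y).
exists t => //.
have tgc : mcyc ((fun x => t (g x)) : P' n -> admod (bopp X)).
  apply: (mcyc_comp (@to_trivR_linear k H^c Y)); exact: mcyc_comp lt gc.
have E : (fun x => t (Psi X g x)) = Psi X (fun x => t (g x)).
  by apply/funext => x; exact: (esym (Psin X X t g tm gc' x)).
have tb' : mbd (fun x => Psi X (fun x => t (g x)) x - Psi X g x) by rewrite -E.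
have := Phie _ _ _ ((Psic _ _).1 tgc) ((Psic _ _).1 gc') tb'.
move=> /(mbd_trans (mbd_sym (PhiPsi _ _ tgc))) /mbd_trans /(_ (PhiPsi _ _ gc')).
exact: (mbd_comp (@of_trivR_linear k H^c Y)).
Qed.

Lemma finitary_unop : finitary P' n -> finitary P n.
Proof.
have [Phi [Psi [Phic Psic PsiPhi PhiPsi [Phie [Psie [Phin Psin]]]]]] := ad_compare Pp Pp' n.
move=> fP Y T Tl Ta g gc; pose X := trivR Y.
have gc' : mcyc (g : P n -> admod X) := mcyc_comp (@to_trivR_linear k H Y) gc.
have [|t Tt tb] := fP (admod (bopp X)) T _ Ta (Phi X g) ((Phic X g).1 gc').
  move=> t /Tl lt; apply: (@ad_map_linear _ _ (bopp X) (bopp X)); apply: bopp_mor.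
  exact: trivR_mor.
have lt := Tl t Tt; have tm : @bimor _ _ X X t by exact: trivR_mor.
exists t => //.
have tgc : mcyc ((fun x => t (g x)) : P n -> admod X).
  apply: (mcyc_comp (@to_trivR_linear k H Y)); exact: mcyc_comp lt gc.
have E : (fun x => t (Phi X g x)) = Phi X (fun x => t (g x)).
  by apply/funext => x; exact: (esym (Phin X X t g tm gc' x)).
have tb' : mbd (fun x => Phi X (fun x => t (g x)) x - Phi X g x) by rewrite -E.
have := Psie _ _ _ ((Phic _ _).1 tgc) ((Phic _ _).1 gc') tb'.
move=> /(mbd_trans (mbd_sym (PsiPhi _ _ tgc))) /mbd_trans /(_ (PsiPhi _ _ gc')).
exact: (mbd_comp (@of_trivR_linear k H Y)).
Qed.

End FinitaryTransfer.

(** * One-dimensional Ext as a cocycle spanning modulo coboundaries *)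

Section ExtDim1.
Variables (k : fieldType) (A : algType k) (M N : lmodType A) (n : nat).
Local Notation P := (std_resolution M).

(** Extracts from the quotient space the one cocycle on which the later arguments operate. Scalars
    appear as [c%:A] because [N] is a module over [A] only. *)
Lemma ext_dim1 : has_dim (Ext M N n) 1 -> exists e : P n -> N,
  [/\ mcyc e, ~ mbd e &
      forall f : P n -> N, mcyc f -> exists c : k, mbd (fun x => f x - c%:A *: e x)].
Proof.
case=> F lF [G FK GK].
pose Z := cocycle N P n.
pose q : Z -> Ext M N n := qproj (coboundary_submodule N P n).
have cyc (z : Z) : mcyc (val z : P n -> N).
  split; first by apply/om_modP; move=> a x y; exact: linearP.
  move=> x; have /eqP := valP z => /(congr1 (fun h : modhom _ _ => h x)).
  exact.
have bdP (z : Z) : coboundary z <-> mbd (val z : P n -> N).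
  rewrite /mbd /Z in z *; case: n z => [|m] z /=.
    split=> [-> //|z0]; apply: val_inj; apply: homP => x; exact: z0.
  split=> [[f fE]|[f /om_modP lf fE]].
    exists f; first by apply/om_modP => a x y; exact: linearP.
    by move=> x; rewrite fE.
  pose f' : modhom (P m) N := HB.pack (f : P m -> N) (GRing.isLinear.Build _ _ _ _ _ lf).
  by exists f'; apply: homP => x; exact: fE.
have mk (f : P n -> N) : mcyc f -> exists z : Z, (val z : P n -> N) = f.
  move=> fc; have lf := mcyc_linear fc.
  pose f' : modhom (P n) N := HB.pack (f : P n -> N) (GRing.isLinear.Build _ _ _ _ _ lf).
  have f'P : hom_comp (res_d P n) f' == 0 by apply/eqP/homP => x; exact: fc.2 x.
  by exists (Ker f'P).
have qE (z : Z) : q z = 0 <-> mbd (val z : P n -> N).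
  rewrite -bdP -{2}[z]subr0 -(qproj_eq (coboundary_submodule N P n)).
  have -> : qproj (coboundary_submodule N P n) 0 = 0 by exact: linear0.
  by [].
(* A representative of the class with coordinate 1. *)
pose e := qrepr (G (const_mx 1)).
have Fe : F (q e) = const_mx 1 by rewrite /q qreprK GK.
exists (val e : P n -> N); split=> //.
  move=> /qE e0; have /matrixP /(_ 0 0) := Fe; rewrite e0 (linE lF).1 !mxE.
  by move/eqP; rewrite eq_sym oner_eq0.
move=> f /mk [z <-]; exists (F (q z) 0 0).
have /qE : q (z - F (q z) 0 0 *: e) = 0; last first.
  by congr (mbd _); apply/funext => x.
have lq : linear q by exact: linear_linear.
apply/eqP; rewrite (linB lq) (linZ lq) subr_eq0; apply/eqP.
apply: (can_inj FK); rewrite (linZ lF) Fe; apply/matrixP => i j.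
by rewrite !ord1 !mxE mulr1.
Qed.

End ExtDim1.

(** * The free bimodule *)

Section FreeBimodule.
Variables (k : fieldType) (A : algType k).
Local Notation T := (tensor A A).

Definition frl (a : A) (t : T) : T := tlift (fun u v : A => (a * u) *t v) t.
Definition frr (b : A) (t : T) : T := tlift (fun u v : A => u *t (v * b)) t.
(** The two inner actions on A (x) A. They commute with the outer ones, hence act on cohomology with
    values in the free bimodule. *)
Definition rho (x y : A) (t : T) : T := tlift (fun u v : A => (u * x) *t (y * v)) t.

Lemma frlE a u v : frl a (u *t v) = (a * u) *t v.
Proof. by apply: tlift_tens; bil. Qed.
Lemma frrE b u v : frr b (u *t v) = u *t (v * b).
Proof. by apply: tlift_tens; bil. Qed.
Lemma rhoE x y u v : rho x y (u *t v) = (u * x) *t (y * v).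
Proof. by apply: tlift_tens; bil. Qed.

Fact frl_bilin : bilin frl.
Proof.
split=> x; first by apply: lin_tlift_fun => [a|u v]; [bil | lin].
by apply: lin_tlift; [bil | lin].
Qed.
Fact frr_bilin : bilin frr.
Proof.
split=> x; first by apply: lin_tlift_fun => [a|u v]; [bil | lin].
by apply: lin_tlift; [bil | lin].
Qed.
Lemma rho_linear x y : linear (rho x y).
Proof. by apply: lin_tlift; [bil | lin]. Qed.

Let ll a : linear (frl a). Proof. exact: frl_bilin.2. Qed.
Let lr a : linear (frr a). Proof. exact: frr_bilin.2. Qed.

Fact frl1 t : frl 1 t = t.
Proof. by apply: (eq_tensor (f := frl 1) (g := fun t => t)) => // u v; rewrite frlE mul1r. Qed.
Fact frlM a b t : frl (a * b) t = frl a (frl b t).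
Proof.
apply: (eq_tensor (f := frl (a * b)) (g := fun t => frl a (frl b t))) => // [|u v].
  exact: lin_comp (ll a) (ll b).
by rewrite !frlE mulrA.
Qed.
Fact frr1 t : frr 1 t = t.
Proof. by apply: (eq_tensor (f := frr 1) (g := fun t => t)) => // u v; rewrite frrE mulr1. Qed.
Fact frrM a b t : frr (a * b) t = frr b (frr a t).
Proof.
apply: (eq_tensor (f := frr (a * b)) (g := fun t => frr b (frr a t))) => // [|u v].
  exact: lin_comp (lr b) (lr a).
by rewrite !frrE mulrA.
Qed.
Fact frlr a b t : frl a (frr b t) = frr b (frl a t).
Proof.
apply: (eq_tensor (f := fun t => frl a (frr b t)) (g := fun t => frr b (frl a t))) => [||u v].
- exact: lin_comp (ll a) (lr b).
- exact: lin_comp (lr b) (ll a).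
- by rewrite frrE !frlE frrE.
Qed.

Definition free_bimod : bimod A := Bimod frl_bilin frr_bilin frl1 frlM frr1 frrM frlr.

Lemma rho_mor x y : @bimor _ _ free_bimod free_bimod (rho x y).
Proof.
have lR := rho_linear x y; split=> // a; apply: eq_tensor => [||u v] /=.
- exact: lin_comp lR (ll a).
- exact: lin_comp (ll a) lR.
- by rewrite frlE !rhoE frlE mulrA.
- exact: lin_comp lR (lr a).
- exact: lin_comp (lr a) lR.
- by rewrite frrE !rhoE frrE mulrA.
Qed.

End FreeBimodule.

(* The map h (x) w |-> free_emb w h is an isomorphism from H (x) H, with H acting on the
   left factor only, to the adjoint module of the free bimodule; its inverse is
   a (x) b |-> sum a_1 (x) b S(S(a_2)), which [free_coef f] composes with id (x) f. *)
Section FreeAdjoint.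
Variables (k : fieldType) (K : hopfAlgType k).
Local Notation S := (@antipode k K).
Local Notation Fr := (free_bimod K).

Definition free_emb (w : K) (h : K^o) : admod Fr := \sum_(p <- sw (h : K)) p.1 *t (w * S p.2).

Definition free_coef (f : {linear K -> k^o}) (t : admod Fr) : K^o :=
  tlift (fun a b : K => \sum_(p <- sw a) (f (b * S (S p.2)) : k) *: p.1) (t : tensor K K).

Fact free_coef_bilin (f : {linear K -> k^o}) :
  bilin (fun a b : K => \sum_(p <- sw a) (f (b * S (S p.2)) : k) *: p.1).
Proof.
split=> x; last by lin.
by apply: (lin_sw (F := fun u v => (f (x * S (S v)) : k) *: u)); bil.
Qed.

Lemma free_coefE f (a b : K) :
  free_coef f (a *t b : tensor K K) = \sum_(p <- sw a) (f (b * S (S p.2)) : k) *: p.1.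
Proof. exact: tlift_tens (free_coef_bilin f). Qed.

Lemma free_coef_klinear f : linear (free_coef f : tensor K K -> K).
Proof. exact: lin_tlift (free_coef_bilin f) (@lin_id _ _). Qed.

Lemma free_emb_klinear w : linear (free_emb w : K -> tensor K K).
Proof. by apply: (lin_sw (F := fun u v : K => u *t (w * S v))); bil. Qed.

Lemma free_emb_wlinear h : linear (free_emb^~ h : K -> tensor K K).
Proof. by rewrite /free_emb; lin. Qed.

Lemma tens_bilin_mul w : bilin (fun u v : K => u *t (w * S v)).
Proof. by bil. Qed.

Lemma free_emb_linear w : linear (free_emb w).
Proof.
apply/om_modP; split=> [x y|a h]; first exact: (linB (free_emb_klinear w)).
rewrite /= adE /free_emb (swM (F := fun u v : K => u *t (w * S v))); last exact: tens_bilin_mul.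
apply: eq_bigr => p _.
have lb : linear (fun t => frl p.1 (frr (S p.2) t)).
  by apply: lin_comp; [exact: (frl_bilin K).2 | exact: (frr_bilin K).2].
rewrite /= (linS lb); apply: eq_bigr => q _.
by rewrite frrE frlE antipodeM mulrA.
Qed.

(** Here S(h_3) S(S(h_2)) = S(S(h_2) h_3) collapses to the counit; so S applied twice, rather than
    an inverse of S, undoes the twist in [free_emb]. *)
Lemma antipode_cancel (W : lmodType k) (G : K -> K -> W) (h : K) : bilin G ->
  \sum_(p <- sw h) \sum_(q <- sw p.1) G q.1 (S p.2 * S (S q.2)) = G h 1.
Proof.
move=> bG; have [Gl Gr] := bG.
rewrite (sw_coassoc (F := fun u v w => G u (S w * S (S v)))).
- transitivity (\sum_(p <- sw h) (counit p.2 : k) *: G p.1 1).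
    apply: eq_bigr => p _.
    under eq_bigr do rewrite -antipodeM.
    rewrite (@sw_antipodel _ _ _ (fun u => G p.1 (S u))) ?antipode1 //.
    exact: lin_comp (Gr p.1) (linear_linear _).
  by rewrite (@sw_counitr _ _ _ (fun u => G u 1)).
- by move=> b c; exact: Gl.
- by move=> a c; apply: lin_comp (Gr a) _; lin.
- by move=> a b; apply: lin_comp (Gr a) _; lin.
Qed.

Lemma antipode_cancel' (W : lmodType k) (G : K -> K -> W) (h : K) : bilin G ->
  \sum_(p <- sw h) \sum_(q <- sw p.1) G q.1 (S (S p.2) * S q.2) = G h 1.
Proof.
move=> bG; have [Gl Gr] := bG.
rewrite (sw_coassoc (F := fun u v w => G u (S (S w) * S v))).
- transitivity (\sum_(p <- sw h) (counit p.2 : k) *: G p.1 1).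
    apply: eq_bigr => p _.
    under eq_bigr do rewrite -antipodeM.
    rewrite (@sw_antipoder _ _ _ (fun u => G p.1 (S u))) ?antipode1 //.
    exact: lin_comp (Gr p.1) (linear_linear _).
  by rewrite (@sw_counitr _ _ _ (fun u => G u 1)).
- by move=> b c; exact: Gl.
- by move=> a c; apply: lin_comp (Gr a) _; lin.
- by move=> a b; apply: lin_comp (Gr a) _; lin.
Qed.

(** On h_1 a (x) b S(h_2) the factors S(h_3) S(S(h_2)) meet in the coefficient and cancel, leaving h
    on the left. *)
Lemma free_coef_linear f : linear (free_coef f).
Proof.
apply/om_modP; split=> [x y|h t]; first exact: (linB (free_coef_klinear f)).
have lq := free_coef_klinear f.
have lad : linear (fun t : tensor K K => (h *: (t : admod Fr) : admod Fr) : tensor K K).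
  exact: (adactr_linear (X := Fr) h).
apply: (@eq_tensor _ _ _ _ (fun t : tensor K K => free_coef f (h *: (t : admod Fr)) : K)
   (fun t : tensor K K => h * (free_coef f t : K))) => [||a b].
- exact: lin_comp lq lad.
- by apply: lin_mulr.
rewrite adE (linS lq) free_coefE.
transitivity (\sum_(p <- sw h) \sum_(q <- sw p.1) \sum_(s <- sw a)
    (f (b * (S p.2 * S (S q.2)) * S (S s.2)) : k) *: (q.1 * s.1)).
  apply: eq_bigr => p _; rewrite /= frrE frlE free_coefE.
  rewrite (swM (F := fun u v => (f (b * S p.2 * S (S v)) : k) *: u)); last by bil.
  apply: eq_bigr => q _; apply: eq_bigr => s _.
  by rewrite !antipodeM !mulrA.
rewrite (antipode_cancel (G := fun u v => \sum_(s <- sw a)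
    (f (b * v * S (S s.2)) : k) *: (u * s.1))); last by bil.
by rewrite mulr_sumr; apply: eq_bigr => s _; rewrite mulr1 scalerAr.
Qed.

Lemma free_coef_free_emb f w (h : K) : free_coef f (free_emb w h) = (f w : k) *: h.
Proof.
rewrite /free_emb (linS (free_coef_klinear f)).
transitivity (\sum_(p <- sw h) \sum_(q <- sw p.1) (f (w * (S p.2 * S (S q.2))) : k) *: q.1).
  by apply: eq_bigr => p _; rewrite free_coefE; apply: eq_bigr => q _; rewrite mulrA.
by rewrite (antipode_cancel (G := fun u v => (f (w * v) : k) *: u)) ?mulr1 //; bil.
Qed.

(** Approximations of the identity that factor through finitely many copies of [K^o]; this is the
    family to which [finitary] is applied. *)
Definition free_approx (l : seq ({linear K -> k^o} * K)) (t : admod Fr) : admod Fr :=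
  \sum_(p <- l) free_emb p.2 (free_coef p.1 t).

Lemma free_approx_linear l : linear (free_approx l).
Proof.
move=> a x y; rewrite /free_approx scaler_sumr -big_split; apply: eq_bigr => p _ /=.
by rewrite free_coef_linear free_emb_linear.
Qed.

Lemma free_approx_klinear l : linear (free_approx l : tensor K K -> tensor K K).
Proof.
by apply: lin_sum => p; exact: lin_comp (free_emb_klinear p.2) (free_coef_klinear p.1).
Qed.

(** The tensor has coordinates a_1 (x) b S(S(a_2)) in the untwisted module, so only the finitely
    many vectors b S(S(a_2)) have to be fixed. *)
Lemma free_approx_tens l (a b : K) :
  {in [seq b * S (S p.2) | p <- sw a], forall v, fin_rank l v = v} ->
  free_approx l (a *t b : tensor K K) = a *t b.
Proof.
move=> lE; transitivity (\sum_(p <- sw a) free_emb (b * S (S p.2)) p.1).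
  rewrite /free_approx; under eq_bigr do rewrite free_coefE (linS (free_emb_klinear _)).
  rewrite exchange_big /=; apply: eq_big_seq => p pa.
  rewrite -[in RHS](lE (b * S (S p.2))); last by apply/mapP; exists p.
  rewrite /fin_rank (linS (free_emb_wlinear p.1)); apply: eq_bigr => r _.
  by rewrite (linZ (free_emb_klinear r.2)) (linZ (free_emb_wlinear p.1)).
transitivity (\sum_(p <- sw a) \sum_(q <- sw p.1) q.1 *t (b * (S (S p.2) * S q.2))).
  by apply: eq_bigr => p _; apply: eq_bigr => q _; rewrite mulrA.
by rewrite (antipode_cancel' (G := fun u v => u *t (b * v))) ?mulr1 //; bil.
Qed.

Lemma free_approx_approx (s : seq (admod Fr)) : exists l, {in s, forall t, free_approx l t = t}.
Proof.
have [r rE] := choice (fun t : tensor K K => tensP t).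
have [l lE] := fin_rank_approx
  (flatten [seq flatten [seq [seq p.2 * S (S q.2) | q <- sw p.1] | p <- r t] | t <- s]).
exists l => t ts; rewrite [in RHS](rE t) [in LHS](rE t) (linS (free_approx_klinear l)).
apply: eq_big_seq => p pt; apply: free_approx_tens => v vp; apply: lE.
apply/flattenP; exists (flatten [seq [seq p.2 * S (S q.2) | q <- sw p.1] | p <- r t]).
  by apply/mapP; exists t.
by apply/flattenP; exists [seq p.2 * S (S q.2) | q <- sw p.1] => //; apply/mapP; exists p.
Qed.

(** Inserting S(S(x_3)) S(x_2), which collapses to the counit, turns h_1 x (x) y w S(h_2) into the
    embedding of h x_1 with w replaced by y w S(S(x_2)), after regrouping. *)
Lemma rho_free_emb x y w (h : K) :
  rho x y (free_emb w h) = \sum_(q <- sw x) free_emb (y * w * S (S q.2)) (h * q.1).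
Proof.
rewrite /free_emb (linS (rho_linear x y)).
transitivity (\sum_(p <- sw h) (p.1 * x) *t (y * w * S p.2)).
  by apply: eq_bigr => p _; rewrite rhoE mulrA.
transitivity (\sum_(p <- sw h) \sum_(q <- sw x) \sum_(r <- sw q.1)
   (p.1 * r.1) *t (y * w * (S (S q.2) * S r.2 * S p.2))).
  apply: eq_bigr => p _.
  rewrite (antipode_cancel' (G := fun u v => (p.1 * u) *t (y * w * (v * S p.2)))) ?mul1r //.
  by bil.
rewrite exchange_big /=; apply: eq_bigr => q _.
rewrite (swM (F := fun u v => u *t (y * w * S (S q.2) * S v))); last by bil.
by apply: eq_bigr => p _; apply: eq_bigr => r _; rewrite antipodeM !mulrA.
Qed.

End FreeAdjoint.

(** * Cohomology with values in the free bimodule *)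

Section FreeCohomology.
Variables (k : fieldType) (K : hopfAlgType k).
Local Notation S := (@antipode k K).
Local Notation Fr := (free_bimod K).
Variables (P : resolution (ltriv K)) (n : nat).

Lemma mbd_sum (Y : lmodType K) (J : Type) (s : seq J) (f : J -> P n -> Y) :
  (forall j, mbd (f j)) -> mbd (fun x => \sum_(j <- s) f j x).
Proof. exact: cobd_sum. Qed.

Lemma mbd_eq (Y : lmodType K) (f g : P n -> Y) : (forall x, f x = g x) -> mbd f -> mbd g.
Proof. by move=> /funext ->. Qed.

Lemma mbd0 (Y : lmodType K) : mbd (fun _ : P n => 0 : Y).
Proof. exact: cobd_zero. Qed.

(** Plays the role of the commutation of Ext with direct sums: modulo coboundaries finitely many
    coordinates of [g] suffice. *)
Lemma cocycle_decomp (g : P n -> admod Fr) : finitary P n -> mcyc g ->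
  exists l, mbd (fun x => \sum_(p <- l) free_emb p.2 (free_coef p.1 (g x)) - g x).
Proof.
move=> fP gc.
have [||t [l ->] tb] := fP (admod Fr) (fun t => exists l, t = free_approx l) _ _ g gc.
- by move=> t [l ->]; exact: free_approx_linear.
- by move=> s; have [l lE] := free_approx_approx s; exists (free_approx l) => //; exists l.
by exists l.
Qed.

(** If w were nonzero, the coordinate along a functional with value 1 at w would exhibit [f] itself
    as a coboundary. *)
Lemma free_emb_unique (f : P n -> K^o) w : ~ mbd f -> mbd (fun x => free_emb w (f x)) -> w = 0.
Proof.
move=> fn wb; apply/eqP/negP => /negP /functional_neq0 [l lw]; apply: fn.
apply: mbd_eq (mbd_comp (free_coef_linear l) wb) => x.
by rewrite free_coef_free_emb lw scale1r.
Qed.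

Lemma free_emb_cyc (f : P n -> K^o) w : mcyc f -> mcyc (fun x => free_emb w (f x)).
Proof. exact/mcyc_comp/free_emb_linear. Qed.

Lemma rho_admod_linear x y : linear (rho x y : admod Fr -> admod Fr).
Proof. exact: (ad_map_linear (rho_mor x y)). Qed.

Definition spanning (e : P n -> K^o) : Prop :=
  [/\ mcyc e, ~ mbd e &
     forall f : P n -> K^o, mcyc f -> exists c : k, mbd (fun x => f x - c%:A *: e x)].

Section OneDimensional.
Variable e : P n -> K^o.
Hypothesis es : spanning e.

Let ec : mcyc e. Proof. by case: es. Qed.
Let en : ~ mbd e. Proof. by case: es. Qed.

Lemma free_emb_scale (c : k) w (h : K) : free_emb w ((c%:A : K) *: (h : K^o)) = free_emb (c *: w) h.
Proof.
rewrite (linZ (free_emb_wlinear h)) -[_ *: (h : K^o)]/(c%:A * h) mulr_algl.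
exact: (linZ (free_emb_klinear w)).
Qed.

(** Each coordinate of [g] is a scalar multiple of [e] modulo coboundaries. With
    [free_emb_e_unique], w becomes a coordinate that identifies the cohomology with [K]. *)
Lemma free_emb_represent (g : P n -> admod Fr) : finitary P n -> mcyc g ->
  exists w, mbd (fun x => g x - free_emb w (e x)).
Proof.
move=> fP gc; have [l lb] := cocycle_decomp fP gc.
have [_ _ eP] := es.
have [c cE] := choice (fun p : {linear K -> k^o} * K => eP _ (mcyc_comp (free_coef_linear p.1) gc)).
exists (\sum_(p <- l) c p *: p.2).
apply: mbd_trans (mbd_sym lb) _.
apply: mbd_eq (mbd_sum l (fun p => mbd_comp (free_emb_linear p.2) (cE p))) => x.
rewrite (linS (free_emb_wlinear _)) -sumrB; apply: eq_bigr => p _.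
by rewrite -free_emb_scale; exact: (linB (free_emb_klinear p.2)).
Qed.

Lemma free_emb_e_unique w w' : mbd (fun x => free_emb w (e x) - free_emb w' (e x)) -> w = w'.
Proof.
move=> wb; apply/eqP; rewrite -subr_eq0; apply/eqP; apply: (free_emb_unique en).
by apply: mbd_eq wb => x; rewrite (linB (free_emb_wlinear _)).
Qed.

Lemma rmul_linear (a : K) : linear ((fun h => (h : K) * a) : K^o -> K^o).
Proof. by move=> b x y; rewrite mulrDl -mulrA. Qed.

Lemma scale_unique (c : k) : mbd (fun x => (c *: (e x : K) : K^o)) -> c = 0.
Proof.
move=> cb; apply/eqP/negP => /negP c0; apply: en.
(* Division by c has to be a [K]-linear map, hence is written as a right multiplication. *)
have lc : linear ((fun h => (h : K) * (c^-1)%:A) : K^o -> K^o) by exact: rmul_linear.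
apply: mbd_eq (mbd_comp lc cb) => x.
by rewrite mulr_algr scalerA mulVf // scale1r.
Qed.

(** Right multiplications are endomorphisms of the left module [K^o], so they act on the line
    spanned by the class of [e], each by a scalar; uniqueness of the scalar makes al linear and
    multiplicative. *)
Lemma character_exists : exists al : K -> k^o,
  [/\ linear al, forall a b, al (a * b) = al a * al b, al 1 = 1 &
     forall a, mbd (fun x => ((e x : K) * a - (al a : k) *: (e x : K) : K^o))].
Proof.
have [_ _ eP] := es.
have ex (a : K) : exists c : k, mbd (fun x => ((e x : K) * a - c *: (e x : K) : K^o)).
  have [c cb] := eP _ (mcyc_comp (rmul_linear a) ec); exists c.
  by apply: mbd_eq cb => x; rewrite -[c%:A *: _]/(c%:A * (e x : K)) mulr_algl.
have uniq (a : K) (c d : k) : mbd (fun x => ((e x : K) * a - c *: (e x : K) : K^o)) ->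
    mbd (fun x => ((e x : K) * a - d *: (e x : K) : K^o)) -> c = d.
  move=> cb db; apply/eqP; rewrite -subr_eq0; apply/eqP; apply: scale_unique.
  apply: mbd_eq (mbd_sub db cb) => x.
  by rewrite opprB [LHS]addrC addrA subrK scalerBl.
have [al alP] := choice ex; exists (al : K -> k^o); split=> //.
- move=> c a b; apply: (uniq _ _ _ (alP _)).
  have lc : linear ((fun h => (h : K) * c%:A) : K^o -> K^o) by exact: rmul_linear.
  apply: mbd_eq (mbd_add (mbd_comp lc (alP a)) (alP b)) => x.
  rewrite mulr_algr mulrDr -scalerAr [(c *: (al a : k^o) + al b : k^o) *: _]scalerDl.
  by rewrite scalerBr scalerA opprD addrACA.
- move=> a b; apply: (uniq _ _ _ (alP _)).
  have lc : linear ((fun h => (h : K) * (al a)%:A) : K^o -> K^o) by exact: rmul_linear.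
  apply: mbd_eq (mbd_add (mbd_comp (rmul_linear b) (alP a)) (mbd_comp lc (alP b))) => x.
  by rewrite mulr_algr mulrBl -scalerAl mulrA scalerBr scalerA addrA subrK.
- apply: (uniq _ _ _ (alP _)).
  by apply: mbd_eq (mbd0 _) => x; rewrite mulr1 scale1r subrr.
Qed.

End OneDimensional.
End FreeCohomology.

(** * The antipode *)

Section Winding.
Variables (k : fieldType) (K : hopfAlgType k) (al : K -> k^o).
Local Notation S := (@antipode k K).
Hypothesis al_lin : linear al.
Hypothesis alM : forall a b, al (a * b) = al a * al b.
Hypothesis al1 : al 1 = 1.

Definition winding (x : K) : K := \sum_(q <- sw x) (al q.1 : k) *: q.2.

Definition twist (x : K) : K := S (S (winding x)).

Let wb : bilin (fun u v : K => (al u : k) *: v).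
Proof. by bil. Qed.

Lemma winding_linear : linear winding.
Proof. exact: lin_sw wb. Qed.

Lemma twistE x : twist x = \sum_(q <- sw x) (al q.1 : k) *: S (S q.2).
Proof.
have lS : linear (fun u => S (S u)) by lin.
by rewrite /twist /winding (linS lS); apply: eq_bigr => q _; rewrite (linZ lS).
Qed.

Lemma twist1 : twist 1 = 1.
Proof. by rewrite /twist /winding (sw1 wb) al1 scale1r !antipode1. Qed.

(** The composite of al with S is the convolution inverse of al: al(S(z_1)) al(z_2) z_3 = al(S(z_1)
    z_2) z_3 = z. *)
Lemma winding_surj z : exists x, winding x = z.
Proof.
exists (\sum_(p <- sw z) (al (S p.1) : k) *: p.2).
rewrite (linS winding_linear).
transitivity (\sum_(p <- sw z) \sum_(q <- sw p.2) (al (S p.1 * q.1) : k) *: q.2).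
  apply: eq_bigr => p _; rewrite (linZ winding_linear) scaler_sumr.
  by apply: eq_bigr => q _; rewrite scalerA alM.
have lal u : linear (fun b : K => al (u * b)) by apply: (lin_comp al_lin); lin.
rewrite -(sw_coassoc (F := fun u v w => (al (S u * v) : k) *: w)).
- transitivity (\sum_(p <- sw z) (counit p.1 : k) *: p.2); last first.
    exact: (@sw_counitl _ _ _ (fun u => u)).
  apply: eq_bigr => p _; have lG : linear (fun v : K => (al v : k) *: p.2) by lin.
  by rewrite (@sw_antipodel _ _ _ _ p.1 lG) al1 scale1r.
- move=> b c; apply: lin_scalel; apply: (lin_comp al_lin); lin.
- by move=> a c; apply: lin_scalel; exact: lal.
- by lin.
Qed.

(** If S kills z = [winding x], then [twist x] = S(S(z)) vanishes, so x and z do. *)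
Lemma twist_inj : (forall x, twist x = 0 -> x = 0) -> injective S.
Proof.
move=> t0; have S0 z : S z = 0 -> z = 0.
  have [x <-] := winding_surj z => Sx0.
  have -> : x = 0 by apply: t0; rewrite /twist Sx0 linear0.
  exact: (linE winding_linear).1.
by move=> x y xy; apply/eqP; rewrite -subr_eq0; apply/eqP/S0; rewrite linearB /= xy subrr.
Qed.

End Winding.

Section RhoAction.
Variables (k : fieldType) (K : hopfAlgType k) (P : resolution (ltriv K)) (n : nat).
Variables (e : P n -> K^o) (al : K -> k^o).
Hypothesis eal : forall a, mbd (fun x => ((e x : K) * a - (al a : k) *: (e x : K) : K^o)).

(** The factor x_1 that [rho_free_emb] leaves on [K^o] is evaluated by the character, which
    assembles the terms S(S(x_2)) into [twist al x]. *)
Lemma rho_free_emb_e x y w :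
  mbd (fun z => rho x y (free_emb w (e z)) - free_emb (y * w * twist al x) (e z)
    : admod (free_bimod K)).
Proof.
apply: mbd_eq (mbd_sum (sw x) (fun q : K * K =>
  mbd_comp (free_emb_linear (y * w * antipode (antipode q.2))) (eal q.1))) => z.
rewrite rho_free_emb twistE mulr_sumr (linS (free_emb_wlinear _)) -sumrB; apply: eq_bigr => q _.
rewrite (linB (free_emb_klinear _)) (linZ (free_emb_klinear _)) -scalerAr.
by rewrite (linZ (free_emb_wlinear _)).
Qed.

End RhoAction.

(** * Duality exchanging the inner actions, and injectivity of the antipode *)

Section Dual.
Variable k : fieldType.

(** Mutually inverse maps on cohomology classes that exchange the left and right inner actions.
    Keeping [K], [L] and [phi] abstract lets [dual_sym] swap the sides without forming the opposite
    of [H^c]. *)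
Definition dual (K L : hopfAlgType k) (P : resolution (ltriv K)) (Q : resolution (ltriv L))
    (n : nat) (phi : K -> L) : Prop :=
  exists (F : (P n -> admod (free_bimod K)) -> (Q n -> admod (free_bimod L)))
         (G : (Q n -> admod (free_bimod L)) -> (P n -> admod (free_bimod K))),
  [/\ forall f, (mcyc f -> mcyc (F f)) /\ (mbd f -> mbd (F f)),
      forall f, (mcyc f -> mcyc (G f)) /\ (mbd f -> mbd (G f)),
      (forall f g, mcyc f -> mcyc g -> mbd (fun x => f x - g x) ->
        mbd (fun x => F f x - F g x)) /\
      (forall f g, mcyc f -> mcyc g -> mbd (fun x => f x - g x) ->
        mbd (fun x => G f x - G g x)),
      (forall f, mcyc f -> mbd (fun x => G (F f) x - f x)) /\
      (forall f, mcyc f -> mbd (fun x => F (G f) x - f x)) &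
      (forall (x y : K) (f : P n -> admod (free_bimod K)), mcyc f ->
        F (fun z => rho x y (f z)) = fun z => rho (phi y) (phi x) (F f z)) /\
      (forall (x y : K) (f : Q n -> admod (free_bimod L)), mcyc f ->
        G (fun z => rho (phi y) (phi x) (f z)) = fun z => rho x y (G f z))].

Lemma dual_sym (K L : hopfAlgType k) (P : resolution (ltriv K)) (Q : resolution (ltriv L)) n
    (phi : K -> L) (psi : L -> K) : cancel psi phi -> dual P Q n phi -> dual Q P n psi.
Proof.
move=> psiK [F [G [Fc Gc [Fe Ge] [GF FG] [Fn Gn]]]]; exists G, F; split=> //.
split=> x y f fc.
  by have := Gn (psi y) (psi x) f fc; rewrite !psiK.
by have := Fn (psi y) (psi x) f fc; rewrite !psiK.
Qed.

Section InjectiveAntipode.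
Variables (K L : hopfAlgType k) (P : resolution (ltriv K)) (Q : resolution (ltriv L)).
Variables (n : nat) (phi : K -> L).
Hypothesis KL : dual P Q n phi.
Hypothesis phi1 : phi 1 = 1.
Hypothesis phi0 : forall x, phi x = 0 -> x = 0.
Hypotheses (Pfin : finitary P n) (Qfin : finitary Q n).

Lemma antipode_injective (e : P n -> K^o) : spanning e -> injective (@antipode k K).
Proof.
move=> es; have [al [al_lin alM al1 eal]] := character_exists es.
have [ec en _] := es.
apply: (twist_inj al_lin alM al1) => y ty; apply: phi0.
have [F [G [Fc Gc [Fe Ge] [GF FG] [Fn Gn]]]] := KL.
(* Every class has a coordinate w, which y sends to w T(y) = 0. *)
have kill (g : P n -> admod (free_bimod K)) : mcyc g ->
    mbd (fun z => rho y 1 (g z) : admod (free_bimod K)).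
  move=> gc; have [w gw] := free_emb_represent es Pfin gc.
  apply: mbd_eq (mbd_add (mbd_comp (rho_admod_linear y 1) gw) (rho_free_emb_e eal y 1 w)) => z.
  rewrite ty mulr0 (linE (free_emb_wlinear _)).1 subr0.
  by rewrite (linB (rho_linear y 1)) subrK.
have kill' (g : Q n -> admod (free_bimod L)) : mcyc g ->
    mbd (fun z => rho 1 (phi y) (g z) : admod (free_bimod L)).
  move=> gc; have rc : mcyc (fun z => rho 1 (phi y) (g z) : admod (free_bimod L)).
    exact: mcyc_comp (rho_admod_linear 1 (phi y)) gc.
  have b := (Fc _).2 (kill _ ((Gc _).1 gc)); have gE := Gn y 1 g gc.
  rewrite phi1 in gE; rewrite -gE in b.
  by apply: mbd_eq (mbd_sub b (FG _ rc)) => z; rewrite opprB addrC subrK.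
(* The class with coordinate 1 has a nonzero image on the other side, so one of the finitely many
   [L^o]-valued cocycles in the decomposition of that image is not a coboundary. *)
have [f fc fn] : exists2 f : Q n -> L^o, mcyc f & ~ mbd f.
  pose g := F (fun x => free_emb 1 (e x)).
  have gc : mcyc g := (Fc _).1 (free_emb_cyc 1 ec).
  have gn : ~ mbd g.
    move=> /(Gc _).2 gb.
    have b : mbd (fun x => free_emb 1 (e x)).
      by apply: mbd_eq (mbd_sub gb (GF _ (free_emb_cyc 1 ec))) => x; rewrite opprB addrC subrK.
    by have /eqP := free_emb_unique en b; rewrite oner_eq0.
  have [l lb] := cocycle_decomp Qfin gc.
  apply: contrapT => nof; apply: gn.
  have fb (p : {linear L -> k^o} * L) : mbd (fun x => free_emb p.2 (free_coef p.1 (g x))).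
    apply: (mbd_comp (free_emb_linear p.2)); apply: contrapT => pn; apply: nof.
    by exists (fun x => free_coef p.1 (g x)) => //; exact: mcyc_comp (free_coef_linear p.1) gc.
  apply: mbd_eq (mbd_sub (mbd_sum l fb) lb) => x.
  by rewrite opprB addrC subrK.
(* The action of [phi y] sends the embedding of [f] along 1 to the one along [phi y], which is a
   coboundary only for [phi y] = 0. *)
apply: (free_emb_unique fn); apply: mbd_eq (kill' _ (free_emb_cyc 1 fc)) => x.
rewrite rho_free_emb.
rewrite (sw1 (F := fun u v => free_emb (phi y * 1 * antipode (antipode v)) ((f x : L) * u))).
  by rewrite !antipode1 !mulr1.
split=> c; first by apply: lin_comp (free_emb_klinear _) _; lin.
by apply: lin_comp (free_emb_wlinear _) _; lin.
Qed.

End InjectiveAntipode.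
End Dual.

(** The flip of H (x) H identifies the opposite of the free bimodule over [H] with the free bimodule
    over [H^c] and exchanges the inner actions; naturality of [ad_compare] applied to the maps
    [rho x y] does the rest. *)
Lemma dual_op (k : fieldType) (H : hopfAlgType k)
    (P : resolution (ltriv H)) (P' : resolution (ltriv H^c)) n :
  (forall n, projective (P n)) -> (forall n, projective (P' n)) ->
  @dual k H H^c P P' n (fun x => x).
Proof.
move=> Pp Pp'.
pose X := free_bimod H; pose Y := @free_bimod k H^c.
pose s : X -> Y := tlift (fun a b : H => (b : H^c) *t (a : H^c)).
pose r : Y -> X := tlift (fun a b : H^c => (b : H) *t (a : H)).
have bs := comul_op_bilin H.
have brr : bilin (fun a b : H^c => (b : H) *t (a : H)).
  by split=> c a x y; [exact: (@tensPr k H H) | exact: (@tensPl k H H)].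
have ls : linear s by exact: lin_tlift bs (@lin_id _ _).
have lr : linear r by exact: lin_tlift brr (@lin_id _ _).
have sE (a b : H) : s (a *t b) = (b : H^c) *t (a : H^c) by exact: tlift_tens.
have rE (a b : H^c) : r (a *t b) = (b : H) *t (a : H) by exact: tlift_tens.
have sK : cancel s r.
  by apply: (@eq_tensor _ _ _ _ _ (fun t => t)) => [||a b] //; [exact: lin_comp | rewrite sE rE].
have rK : cancel r s.
  by apply: (@eq_tensor _ _ _ _ _ (fun t => t)) => [||a b] //; [exact: lin_comp | rewrite rE sE].
have sm : @bimor _ _ (bopp X) Y s.
  split=> // a; apply: eq_tensor => [||u v].
  - by apply: lin_comp ls _; exact: (@br_bilin _ _ X).2.
  - by apply: lin_comp _ ls; exact: (@bl_bilin _ _ Y).2.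
  - by rewrite /= frrE !sE; exact/esym/(@frlE k H^c).
  - by apply: lin_comp ls _; exact: (@bl_bilin _ _ X).2.
  - by apply: lin_comp _ ls; exact: (@br_bilin _ _ Y).2.
  - by rewrite /= frlE !sE; exact/esym/(@frrE k H^c).
have rm : @bimor _ _ Y (bopp X) r by apply: (bimor_inv (f := s : bopp X -> Y)) sm.
have sl := ad_map_linear sm; have rl := ad_map_linear rm.
have s_rho x y t : s (rho x y t) = @rho k H^c y x (s t).
  apply: (@eq_tensor _ _ _ _ (fun t => s (rho x y t)) (fun t => @rho k H^c y x (s t))) => [||u v].
  - exact: lin_comp ls (rho_linear x y).
  - exact: lin_comp (@rho_linear k H^c y x) ls.
  - by rewrite rhoE !sE; exact/esym/(@rhoE k H^c).
have r_rho (x y : H) t : r (@rho k H^c y x t) = rho x y (r t) by rewrite -{1}[t]rK -s_rho sK.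
have [Phi [Psi [Phic Psic PsiPhi PhiPsi [Phie [Psie [Phin Psin]]]]]] := ad_compare Pp Pp' n.
exists (fun f x => s (Phi X f x)), (fun f => Psi X (fun x => r (f x))).
have sB := linB ls; have rB := linB lr.
split.
- by move=> f; split=> [/(Phic X f).1|/(Phic X f).2]; [exact: mcyc_comp | exact: mbd_comp].
- by move=> f; split=> [/(mcyc_comp rl)/(Psic X _).1|/(mbd_comp rl)/(Psic X _).2].
- split=> f g fc gc fg.
    by apply: mbd_eq (mbd_comp sl (Phie _ _ _ fc gc fg)) => x; exact: sB.
  apply: Psie; [exact: mcyc_comp rl fc | exact: mcyc_comp rl gc |].
  by apply: mbd_eq (mbd_comp rl fg) => x; exact: rB.
- split=> f fc.
    have -> : (fun x => r (s (Phi X f x))) = Phi X f by apply/funext => x; exact: sK.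
    exact: PsiPhi.
  apply: mbd_eq (mbd_comp sl (PhiPsi X _ (mcyc_comp rl fc))) => x.
  by rewrite sB rK.
- split=> x y f fc.
    apply/funext => z; rewrite -s_rho; congr s.
    exact: (Phin X X (rho x y) f (rho_mor x y) fc).
  have -> : (fun z => r (@rho k H^c y x (f z))) = (fun z => rho x y (r (f z))).
    by apply/funext => z; exact: r_rho.
  apply/funext => z.
  exact: (Psin X X (rho x y) _ (rho_mor x y) (mcyc_comp rl fc)).
Qed.

Lemma inj_surj_bij (T U : Type) (f : T -> U) : injective f -> (forall y, exists x, f x = y) ->
  bijective f.
Proof.
move=> fi /choice [g gK]; exists g => // x; exact: fi.
Qed.

(** * Surjectivity of the antipode from one-dimensional Ext on both sides *)

Section BijectiveAntipode.
Variables (k : fieldType) (H : hopfAlgType k).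
Variables (P : resolution (ltriv H)) (P' : resolution (ltriv H^c)) (n : nat).
Hypothesis HH : @dual k H H^c P P' n (fun x => x).
Hypotheses (Pfin : finitary P n) (Pfin' : finitary P' n).
Variables (e : P n -> H^o) (e' : P' n -> (H^c)^o).
Hypotheses (es : spanning e) (es' : spanning e').

Theorem antipode_surjective :
  (forall x : H, (exists y : H, y * x = 1) -> regular_elt x) \/
  (forall x : H, (exists y : H, x * y = 1) -> regular_elt x) ->
  forall z, exists x : H, antipode x = z.
Proof.
have [al [al_lin alM al1 eal]] := character_exists es.
have [al' [al_lin' alM' al1' eal']] := character_exists es'.
have [ec en _] := es; have [ec' en' _] := es'.
have [F [G [Fc Gc [Fe Ge] [GF FG] [Fn Gn]]]] := HH.
pose Y := free_bimod H^c.
(* The graph of Theta in the coordinates given by [e] and [e']; a relation is natural here, since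
   [F] is controlled only modulo coboundaries. *)
pose rel (w w' : H) : Prop :=
  mbd (fun x => F (fun y => free_emb w (e y)) x - free_emb (w' : H^c) (e' x) : admod Y).
have rel_l w : exists w', rel w w'.
  exact: (free_emb_represent es' Pfin' ((Fc _).1 (free_emb_cyc w ec))).
have rel_r w' : exists w, rel w w'.
  have gc' := @free_emb_cyc k H^c P' n e' w' ec'; have gc := (Gc _).1 gc'.
  have [w wb] := free_emb_represent es Pfin gc; exists w.
  have := Fe _ _ (free_emb_cyc w ec) gc (mbd_sym wb) => b.
  exact: mbd_trans b (FG _ gc').
have rel_ul w w1 w2 : rel w w1 -> rel w w2 -> w1 = w2.
  by move=> r1 r2; apply: (free_emb_e_unique es'); exact: mbd_trans (mbd_sym r1) r2.
have rel_ur w1 w2 w' : rel w1 w' -> rel w2 w' -> w1 = w2.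
  move=> r1 r2; apply: (free_emb_e_unique es).
  have c1 := free_emb_cyc w1 ec; have c2 := free_emb_cyc w2 ec.
  have b := Ge _ _ ((Fc _).1 c1) ((Fc _).1 c2) (mbd_trans r1 (mbd_sym r2)).
  exact: mbd_trans (mbd_sym (GF _ c1)) (mbd_trans b (GF _ c2)).
have rel_act w w' x y : rel w w' ->
    rel (y * w * twist al x) ((twist al' y : H) * w' * x).
  move=> r; have cw := free_emb_cyc w ec; have cw' := @free_emb_cyc k H^c P' n e' w' ec'.
  have rc := mcyc_comp (rho_admod_linear x y) cw.
  have b1 := Fe _ _ (free_emb_cyc _ ec) rc (mbd_sym (rho_free_emb_e eal x y w)).
  have b2 : mbd (fun z => F (fun z => rho x y (free_emb w (e z))) z -
      @rho k H^c y x (free_emb (w' : H^c) (e' z)) : admod Y).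
    rewrite (Fn x y _ cw).
    apply: mbd_eq (mbd_comp (@rho_admod_linear k H^c y x) r) => z.
    exact: (linB (@rho_linear k H^c y x)).
  have b3 := @rho_free_emb_e k H^c P' n e' al' eal' y x w'.
  rewrite /rel; apply: mbd_trans b1 (mbd_trans b2 _).
  (* The formula for [rho] over [H^c] uses the reversed product. *)
  have E : (twist al' y : H) * w' * x = ((x : H^c) * (w' : H^c) * twist al' y : H^c).
    exact: esym (@mulrA H (twist al' y) w' x).
  by rewrite E.
have t1 : twist al 1 = 1 := twist1 al_lin al1.
have t1' : twist al' 1 = 1 := @twist1 k H^c al' al_lin' al1'.
have [g rg] := rel_l 1; have [c rc] := rel_r 1.
have gP z : exists y, (twist al' y : H) * g = z.
  (* Here y is the preimage of z under Theta, compared with the image of y acting on the pair (1,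
     g). *)
  have [y ry] := rel_r z; exists y; apply: rel_ul ry.
  by have := rel_act _ _ 1 y rg; rewrite t1 !mulr1.
have cP z : exists x, c * twist al x = z.
  have [x rx] := rel_l z; exists x; apply: rel_ur rx.
  by have := rel_act _ _ x 1 rc; rewrite [twist al' 1]t1' !mul1r.
(* Condition (iii) is applied to g and (iv) to c. Cancelling in T'(x) g = z g, respectively in c
   T(x) = c z, leaves z as a value of T' or T, hence of S. *)
case=> reg z.
  have [y yg] := gP 1; have [_ rr] : regular_elt g by apply: reg; exists (twist al' y).
  have [x xg] := gP (z * g); exists (antipode (winding al' x : H)).
  exact: rr xg.
have [y cy] := cP 1; have [ll _] : regular_elt c by apply: reg; exists (twist al y).
have [x cx] := cP (c * z); exists (antipode (winding al x)).
exact: ll cx.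
Qed.

End BijectiveAntipode.

Theorem theorem0p2 (k : fieldType) (H : hopfAlgType k) :
  has_fg_projective_resolution (ltriv H) \/ has_fg_projective_resolution (rtriv H) ->
  ((exists i : nat, has_dim (Ext (ltriv H) H^o i) 1) \/
   (exists j : nat, has_dim (Ext (rtriv H) (H^c)^o j) 1) ->
     injective (antipode : H -> H))
  /\
  ((exists i : nat, has_dim (Ext (ltriv H) H^o i) 1 /\
                    has_dim (Ext (rtriv H) (H^c)^o i) 1) ->
   (forall x : H, (exists y : H, y * x = 1) -> regular_elt x) \/
   (forall x : H, (exists y : H, x * y = 1) -> regular_elt x) ->
     bijective (antipode : H -> H)).
Proof.
(* By conversion [rtriv H] is [ltriv H^c], so the right side is the left side of the opposite Hopf
   algebra. *)
move=> fg; pose P := std_resolution (ltriv H); pose P' := std_resolution (rtriv H).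
have Pp n : projective (P n) by exact: std_resolution_projective.
have Pp' n : projective (P' n) by exact: std_resolution_projective.
have fin n : finitary P n /\ finitary P' n.
  have P'fin := @finitary_op k H P P' Pp Pp' n.
  have Pfin := @finitary_unop k H P P' Pp Pp' n.
  case: fg => [[Q QP]|[Q QP]].
    by have f := finitary_fg (n := n) Pp QP; split=> //; exact: P'fin.
  by have f := finitary_fg (n := n) Pp' QP; split=> //; exact: Pfin.
have HH n : @dual k H H^c P P' n (fun x => x) by exact: dual_op.
have inj : (exists i : nat, has_dim (Ext (ltriv H) H^o i) 1) \/
   (exists j : nat, has_dim (Ext (rtriv H) (H^c)^o j) 1) -> injective (antipode : H -> H).
  case=> [[n] | [n]] /ext_dim1 [e es].
    exact: (antipode_injective (HH n) erefl (fun x x0 => x0) (fin n).1 (fin n).2 es).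
  (* Under condition (ii) the one-dimensional side is [H^c], whose antipode is the same map. *)
  have HH' : @dual k H^c H P' P n (fun x => x) by apply: dual_sym (HH n).
  exact: (antipode_injective HH' erefl (fun x x0 => x0) (fin n).2 (fin n).1 es).
split=> // -[n [/[dup] d /ext_dim1 [e es] /ext_dim1 [e' es']]] reg.
apply: inj_surj_bij; first by apply: inj; left; exists n.
exact: (antipode_surjective (HH n) (fin n).1 (fin n).2 es es' reg).
Qed.
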